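(* Let $k\ge 2$, let $C_i=(M_i^3,\varphi_i,\xi_i,\eta_i,g_i)$, $i=1,\dots,k$, be cells, let $M=C_1\times\dots\times C_k$ be their product with its canonical almost metric $f$-structure $(f,\bar g,\bar\xi_1,\dots,\bar\xi_k)$ and median vector field $\bar\xi$, let $N=C_1-\dots-C_k\subset M$ be a manifold of sewed cells, and let $\iota:N\to M$ be the inclusion. Then the tensor fields $\varphi=f|_N$, $\xi=\bar\xi|_N$, $\eta=\sqrt{k}\,\iota^*\bar\eta_1$, $g=\bar g|_N$ define an almost contact metric structure on $N$. Moreover $$d\eta=0,\qquad \eta\wedge d\varPhi=0,$$ where $\varPhi(X,Y)=g(X,\varphi Y)$ is the fundamental form of $N$.
   Context: An almost contact metric structure on a manifold is a quadruple $(\varphi,\xi,\eta,g)$ of a $(1,1)$-tensor field (affinor) $\varphi$, a vector field $\xi$, a one-form $\eta$ and a Riemannian metric $g$ with $\varphi^2=-Id+\eta\otimes\xi$, $\eta(\xi)=1$, $g(\varphi X,\varphi Y)=g(X,Y)-\eta(X)\eta(Y)$. A cell is a 3-dimensional almost contact metric manifold $(M^3,\varphi,\xi,\eta,g)$ with $d\eta=0$. Product of cells: $M=C_1\times\dots\times C_k$ with projections $\pi_i:M\to C_i$; $D_i=\bigcap_{j\ne i}\mathrm{Ker}\,\pi_{*j}$, so $TM=D_1\oplus\dots\oplus D_k$. The lift of a vector field $X$ on $C_i$ is the unique vector field $\bar X\in\Gamma(D_i)$ with $\pi_{*i}(\bar X)=X$. $\bar\varphi_i$ is the $(1,1)$-tensor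 field on $M$ with $\bar\varphi_i\bar X=\overline{\varphi_iX}$ for lifts $\bar X$ of vector fields on $C_i$ and $\bar\varphi_i=0$ on $D_j$, $j\neq i$. The canonical structure is $f=\sum_{i=1}^k\bar\varphi_i$, $\bar g=\sum_{i=1}^k\pi_i^*g_i$, $\bar\xi_i$ = the lift of $\xi_i$, $\bar\eta_i=\pi_i^*\eta_i$. The median vector field is $\bar\xi=(\bar\xi_1+\dots+\bar\xi_k)/\sqrt{k}$. The distribution $Im(f)\oplus\mathbb{R}\bar\xi$ on $M$ is involutive; the (maximal connected) integral submanifold $N\subset M$ of it through a point of $M$ is called a manifold of sewed cells (or sewed cells) and is denoted $N=C_1-C_2-\dots-C_k$. It has dimension $2k+1$ and is $f$-invariant. *)

(* Defs.v *)
(* Smooth manifolds are not in the library.  Here a manifold carries a smooth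
   atlas, and tensor fields are given classically, by their components in every
   chart of the atlas together with the transformation law between charts.  In
   every definition the components in a chart [a] are only constrained at the
   points of [chart_dom a].  Only the finite-dimensional model spaces
   'M[R]_(m, n) are used in the sequel. *)
From HB Require Import structures.
From mathcomp Require Import all_boot all_order all_algebra.
From mathcomp Require Import all_classical all_reals all_analysis.

Set Implicit Arguments.
Unset Strict Implicit.
Unset Printing Implicit Defensive.

Import Order.TTheory GRing.Theory Num.Theory.
Import numFieldNormedType.Exports.
Local Open Scope classical_set_scope.
Local Open Scope ring_scope.

Section Smooth.
Context {R : realType}.

(* Class C^n on the open set [U]; for a finite-dimensional [V] it is the usual
   notion, expressed with all directional derivatives instead of the partial
   derivatives in a basis. *)
Fixpoint class_C (n : nat) {V W : normedModType R} (U : set V) (f : V -> W) :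
    Prop :=
  if n is m.+1 then
    (forall x, U x -> differentiable f x) /\ (forall v, class_C m U ('D_v f))
  else forall x, U x -> {for x, continuous f}.

Definition smooth_on {V W : normedModType R} (U : set V) (f : V -> W) :=
  forall n, class_C n U f.

End Smooth.

Section SmoothTheory.
Context {R : realType}.
Implicit Types V W : normedModType R.

Lemma near_eq_diff V W (f g : V -> W) x : (\forall y \near x, f y = g y) ->
  differentiable f x -> differentiable g x /\ 'd g x = 'd f x :> (V -> W).
Proof.
move=> fg df; have fgx : f x = g x := nbhs_singleton fg.
have fg0 : \forall y \near 0, f (y + x) = g (y + x).
  by move: fg; rewrite (near_shift 0) subr0.
have gE : g \o shift x = cst (g x) + 'd f x +o_ 0 id.
  apply/eqaddoP => e e0; move/diff_locally/eqaddoP: (df) => /(_ e e0).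
  apply: filterS2 fg0 => y fgy.
  by rewrite !fctE /= -fgx -fgy.
have dE : 'd g x = 'd f x :> (V -> W).
  by apply: diff_unique gE; exact: diff_continuous.
split=> //; apply/diff_locallyP; rewrite dE; split=> //.
exact: diff_continuous.
Qed.

Lemma eq_class_C n V W (U : set V) (f g : V -> W) :
  open U -> (forall x, U x -> f x = g x) -> class_C n U f -> class_C n U g.
Proof.
move=> oU; elim: n f g => [|n IH] f g fg.
  move=> cf x Ux; have nfg : \forall y \near x, f y = g y.
    by apply: filterS (open_nbhs_nbhs (conj oU Ux)).
  apply: cvg_trans (_ : f y @[y --> x] --> g x).
    by apply: near_eq_cvg; apply: filterS nfg => y ->.
  by rewrite -fg //; exact: cf.
move=> [df Df]; split=> [x Ux|v].
  have nfg : \forall y \near x, f y = g y.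
    by apply: filterS (open_nbhs_nbhs (conj oU Ux)).
  by have [] := near_eq_diff nfg (df x Ux).
apply: IH (Df v) => x Ux; apply: near_eq_derive.
by apply: filterS (open_nbhs_nbhs (conj oU Ux)).
Qed.

Lemma sub_class_C n V W (U U' : set V) (f : V -> W) :
  U `<=` U' -> class_C n U' f -> class_C n U f.
Proof.
move=> UU'; elim: n f => [|n IH] f /= => [cf x /UU' /cf //|[df Df]].
by split=> [x /UU' /df //|v]; exact: IH.
Qed.

Lemma class_C0 n V W (U : set V) : class_C n U (0 : V -> W).
Proof.
elim: n => [|n IH] /=; first by move=> x _; exact: cst_continuous.
split=> [x _|v]; first exact: differentiable_cst.
rewrite (_ : 'D_v 0 = 0); first exact: IH.
by apply/funext => x; rewrite derive_cst.
Qed.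

Lemma class_CD n V W (U : set V) (f g : V -> W) : open U ->
  class_C n U f -> class_C n U g -> class_C n U (f + g).
Proof.
move=> oU; elim: n f g => [|n IH] f g /=.
  by move=> cf cg x Ux; apply: continuousD; [exact: cf|exact: cg].
move=> [df Df] [dg Dg]; split=> [x Ux|v].
  by apply: differentiableD; [exact: df|exact: dg].
apply: (eq_class_C oU _ (IH _ _ (Df v) (Dg v))) => x Ux.
by rewrite deriveD //; apply: diff_derivable; [exact: df|exact: dg].
Qed.

Lemma class_C_sum n V W (U : set V) m (f : 'I_m -> V -> W) : open U ->
  (forall i, class_C n U (f i)) -> class_C n U (\sum_i f i).
Proof.
move=> oU Cf; elim/big_ind: _ => [|g h Cg Ch|i _].
- exact: class_C0.
- exact: class_CD.
- exact: Cf.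
Qed.

Lemma class_C_precomp n V V' W (U : set V') (L : {linear V -> V'})
    (f : V' -> W) : continuous L ->
  class_C n U f -> class_C n (L @^-1` U) (f \o L).
Proof.
move=> cL; elim: n f => [|n IH] f /=.
  by move=> cf x Ux; apply: continuous_comp; [exact: cL|exact: cf].
move=> [df Df]; split=> [x Ux|v].
  apply: differentiable_comp; last exact: df.
  exact: linear_differentiable.
rewrite (_ : 'D_v (f \o L) = 'D_(L v) f \o L); first exact: (IH _ (Df _)).
apply/funext => x; rewrite /= /derive.
rewrite (_ : (fun h => h^-1 *: ((_ \o shift x) (h *: v) - _)) =
  (fun h => h^-1 *: ((f \o shift (L x)) (h *: L v) - f (L x)))) //.
by apply/funext => h /=; rewrite [L (_ + _)]linearD [L (_ *: _)]linearZ.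
Qed.

Lemma class_C_postcomp n V W W' (U : set V) (L : {linear W -> W'})
    (f : V -> W) : open U -> continuous L ->
  class_C n U f -> class_C n U (L \o f).
Proof.
move=> oU cL; elim: n f => [|n IH] f /=.
  by move=> cf x Ux; apply: continuous_comp; [exact: cf|exact: cL].
move=> [df Df]; split=> [x Ux|v].
  by apply: differentiable_comp; [exact: df|exact: linear_differentiable].
apply: (eq_class_C oU _ (IH _ (Df v))) => x Ux /=.
have dfx := df x Ux.
have dL : differentiable L (f x) by exact: linear_differentiable.
rewrite (deriveE v dfx) deriveE; last exact: differentiable_comp.
by rewrite (diff_comp dfx dL) /= (diff_lin (f x) cL).
Qed.

End SmoothTheory.

Section Blocks.
Context {R : realType} {k n : nat}.

(* The inclusion of the i-th factor of (R^n)^k. *)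
Definition block (i : 'I_k) (u : 'rV[R]_n) : 'M[R]_(k, n) :=
  \matrix_(j, l) if j == i then u ord0 l else 0.

Fact block_is_linear i : linear (block i).
Proof.
move=> a u v; apply/matrixP => j l; rewrite !mxE.
by case: ifP => _; rewrite ?mulr0 ?addr0.
Qed.
HB.instance Definition _ i :=
  GRing.isLinear.Build R 'rV[R]_n 'M[R]_(k, n) _ (block i) (block_is_linear i).

Lemma row_block i j u : row j (block i u) = if j == i then u else 0.
Proof.
by apply/rowP => l; rewrite !mxE; case: ifP => _; rewrite ?mxE.
Qed.

Lemma sum_block (x : 'M[R]_(k, n)) : x = \sum_i block i (row i x).
Proof.
apply/row_matrixP => j; rewrite linear_sum (bigD1 j) //= row_block eqxx.
by rewrite big1 ?addr0 // => i /negPf ij; rewrite row_block eq_sym ij.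
Qed.

Lemma block_continuous i : continuous (block i).
Proof.
move=> u A [P uP PA].
exists (fun _ l => P i l) => [j l|w Pw].
  by have := uP i l; rewrite mxE eqxx [j]ord1.
apply: PA => j l; rewrite mxE; case: eqP => [->|/eqP ji]; first exact: Pw.
by have := uP j l; rewrite mxE (negPf ji) => /nbhs_singleton.
Qed.

Lemma row_continuous i : continuous (row i : 'M[R]_(k, n) -> 'rV[R]_n).
Proof.
move=> x A [P xP PA].
exists (fun j l => if j == i then P ord0 l else setT) => [j l|w Pw].
  case: eqP => [->|_]; last exact: filterT.
  by have := xP ord0 l; rewrite mxE.
by apply: PA => j l; have := Pw i l; rewrite eqxx mxE [j]ord1.
Qed.

End Blocks.

Section Manifold.
Context {R : realType}.
Implicit Types V W : normedModType R.

(* [chart_inv a] is the inverse of the coordinate map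
   [chart_map a : chart_dom a -> V]. *)
Record charted_space V := ChartedSpace {
  points :> topologicalType ;
  chart : Type ;
  chart_dom : chart -> set points ;
  chart_map : chart -> points -> V ;
  chart_inv : chart -> V -> points }.
Arguments chart {V} M : rename.
Arguments chart_dom {V} [M] : rename.
Arguments chart_map {V} [M] : rename.
Arguments chart_inv {V} [M] : rename.

Record is_manifold V (M : charted_space V) : Prop := IsManifold {
  mfd_hausdorff : hausdorff_space M ;
  mfd_second_countable : @second_countable M ;
  mfd_cover : forall p : M, exists a : chart M, chart_dom a p ;
  mfd_dom_open : forall a : chart M, open (chart_dom a) ;
  mfd_image_open : forall a : chart M, open (chart_map a @` chart_dom a) ;
  mfd_mapK : forall (a : chart M) p, chart_dom a p ->
    chart_inv a (chart_map a p) = p ;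
  mfd_map_continuous : forall (a : chart M) p, chart_dom a p ->
    {for p, continuous (chart_map a)} ;
  mfd_inv_continuous : forall (a : chart M) x, (chart_map a @` chart_dom a) x ->
    {for x, continuous (chart_inv a)} ;
  mfd_transition : forall a b : chart M,
    smooth_on (chart_map a @` (chart_dom a `&` chart_dom b))
              (chart_map b \o chart_inv a) }.

Record manifold V := Manifold {
  mspace :> charted_space V ;
  manifoldP : is_manifold mspace }.

Definition smooth_map V W (M : manifold V) (N : manifold W) (F : M -> N) :=
  continuous F /\
  forall (a : chart M) (b : chart N),
    smooth_on (chart_map a @` (chart_dom a `&` F @^-1` chart_dom b))
              (chart_map b \o F \o chart_inv a).

(* The tangent map F_* at p, in the coordinates of [a] at p and [b] at F p. *)
Definition tangent_map V W (M : charted_space V) (N : charted_space W)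
    (F : M -> N) (a : chart M) (b : chart N) (p : M) (v : V) : W :=
  'd (chart_map b \o F \o chart_inv a) (chart_map a p) v.

End Manifold.

Arguments chart {R V} M : rename.
Arguments chart_dom {R V} [M] : rename.
Arguments chart_map {R V} [M] : rename.
Arguments chart_inv {R V} [M] : rename.

Section Tensors.
Context {R : realType} {V : normedModType R} (M : manifold V).

Definition vfield := chart M -> M -> V.
Definition covector_field := chart M -> M -> V -> R.
Definition endo_field := chart M -> M -> V -> V.
Definition bilinear_field := chart M -> M -> V -> V -> R.
Definition form (k : nat) := chart M -> M -> ('I_k -> V) -> R.

Let jac (a b : chart M) (p : M) : V -> V := tangent_map (@idfun M) a b p.
Let img (a : chart M) : set V := chart_map a @` chart_dom a.

Record is_vfield (X : vfield) : Prop := IsVField {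
  vfield_change : forall (a b : chart M) p, chart_dom a p -> chart_dom b p ->
    X b p = jac a b p (X a p) ;
  vfield_smooth : forall a : chart M,
    smooth_on (img a) (fun x => X a (chart_inv a x)) }.

Record is_covector_field (w : covector_field) : Prop := IsCovectorField {
  covector_linear : forall (a : chart M) p, chart_dom a p -> scalar (w a p) ;
  covector_change : forall (a b : chart M) p v,
    chart_dom a p -> chart_dom b p ->
    w a p v = w b p (jac a b p v) ;
  covector_smooth : forall (a : chart M) v,
    smooth_on (img a) (fun x => w a (chart_inv a x) v) }.

Record is_endo_field (T : endo_field) : Prop := IsEndoField {
  endo_linear : forall (a : chart M) p, chart_dom a p -> linear (T a p) ;
  endo_change : forall (a b : chart M) p v, chart_dom a p -> chart_dom b p ->
    jac a b p (T a p v) = T b p (jac a b p v) ;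
  endo_smooth : forall (a : chart M) v,
    smooth_on (img a) (fun x => T a (chart_inv a x) v) }.

Record is_metric (g : bilinear_field) : Prop := IsMetric {
  metric_linear : forall (a : chart M) p u, chart_dom a p -> scalar (g a p u) ;
  metric_sym : forall (a : chart M) p u v, chart_dom a p ->
    g a p u v = g a p v u ;
  metric_pos : forall (a : chart M) p v, chart_dom a p ->
    v != 0 -> 0 < g a p v v ;
  metric_change : forall (a b : chart M) p u v,
    chart_dom a p -> chart_dom b p ->
    g a p u v = g b p (jac a b p u) (jac a b p v) ;
  metric_smooth : forall (a : chart M) u v,
    smooth_on (img a) (fun x => g a (chart_inv a x) u v) }.

Definition form_of_covector (w : covector_field) : form 1 :=
  fun a p v => w a p (v ord0).

(* d is normalised without the factor 1/(k+1). *)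
Definition ext_deriv k (w : form k) : form k.+1 := fun a p v =>
  \sum_(i < k.+1)
    (-1) ^+ i *
    'D_(v i) (fun x => w a (chart_inv a x) (v \o lift i)) (chart_map a p).

Definition wedge1 k (w : covector_field) (b : form k) : form k.+1 :=
  fun a p v => \sum_(i < k.+1) (-1) ^+ i * (w a p (v i) * b a p (v \o lift i)).

Definition form_eq0 k (w : form k) :=
  forall (a : chart M) p (v : 'I_k -> V), chart_dom a p -> w a p v = 0.

Record almost_contact_metric (phi : endo_field) (xi : vfield)
    (eta : covector_field) (g : bilinear_field) : Prop := AlmostContactMetric {
  acm_phi : is_endo_field phi ;
  acm_xi : is_vfield xi ;
  acm_eta : is_covector_field eta ;
  acm_g : is_metric g ;
  acm_phi2 : forall (a : chart M) p v, chart_dom a p ->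
    phi a p (phi a p v) = - v + eta a p v *: xi a p ;
  acm_eta_xi : forall (a : chart M) p, chart_dom a p -> eta a p (xi a p) = 1 ;
  acm_compatible : forall (a : chart M) p u v, chart_dom a p ->
    g a p (phi a p u) (phi a p v) = g a p u v - eta a p u * eta a p v }.

Definition fundamental_form (phi : endo_field) (g : bilinear_field) : form 2 :=
  fun a p v => g a p (v ord0) (phi a p (v ord_max)).

(* A distribution, as the family of its fibres in coordinates. *)
Definition distribution := chart M -> M -> set V.

End Tensors.

Section Submanifold.
Context {R : realType} {V W : normedModType R} (M : manifold V).

(* Immersed submanifolds of [M] are given by an injective immersion
   [iota : N -> M], the inclusion. *)
Definition integral_submanifold (D : distribution M) (N : manifold W)
    (iota : N -> M) :=
  [/\ smooth_map iota, injective iota &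
      forall (a : chart N) (b : chart M) q,
        chart_dom a q -> chart_dom b (iota q) ->
        injective (tangent_map iota a b q) /\
        range (tangent_map iota a b q) = D b (iota q)].

Definition maximal_integral_submanifold (D : distribution M) (N : manifold W)
    (iota : N -> M) :=
  [/\ integral_submanifold D iota, [set: N] !=set0, connected [set: N] &
      forall (N' : manifold W) (iota' : N' -> M),
        integral_submanifold D iota' -> connected [set: N'] ->
        range iota `<=` range iota' -> range iota' `<=` range iota].

Context (N : manifold W) (iota : N -> M).

Definition restricts_endo (T' : endo_field N) (T : endo_field M) :=
  forall (a : chart N) (b : chart M) q v,
    chart_dom a q -> chart_dom b (iota q) ->
    tangent_map iota a b q (T' a q v) =
    T b (iota q) (tangent_map iota a b q v).

Definition restricts_vfield (X' : vfield N) (X : vfield M) :=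
  forall (a : chart N) (b : chart M) q, chart_dom a q -> chart_dom b (iota q) ->
    tangent_map iota a b q (X' a q) = X b (iota q).

Definition pullback_covector (w' : covector_field N) (w : covector_field M) :=
  forall (a : chart N) (b : chart M) q v,
    chart_dom a q -> chart_dom b (iota q) ->
    w' a q v = w b (iota q) (tangent_map iota a b q v).

Definition pullback_bilinear (g' : bilinear_field N) (g : bilinear_field M) :=
  forall (a : chart N) (b : chart M) q u v,
    chart_dom a q -> chart_dom b (iota q) ->
    g' a q u v =
    g b (iota q) (tangent_map iota a b q u) (tangent_map iota a b q v).

End Submanifold.

Lemma overlap_open {R : realType} {V : normedModType R} (M : manifold V)
    (a b : chart M) : open (chart_map a @` (chart_dom a `&` chart_dom b)).
Proof.
have mM := manifoldP M.
rewrite openE => _ [p [ap bp] <-].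
have imgp : (chart_map a @` chart_dom a) (chart_map a p) by exists p.
have nb : nbhs (chart_inv a (chart_map a p)) (chart_dom b).
  rewrite (mfd_mapK mM ap).
  by apply: open_nbhs_nbhs; split=> //; exact: mfd_dom_open.
have := mfd_inv_continuous mM imgp nb.
apply: filterS2 (open_nbhs_nbhs (conj (mfd_image_open mM a) imgp)).
move=> _ [q aq <-] bq; exists q => //; split=> //.
by rewrite -(mfd_mapK mM aq).
Qed.

Section Product.
Context {R : realType} {k n : nat} (C : 'I_k -> manifold 'rV[R]_n).

Definition product_space : charted_space 'M[R]_(k, n) := {|
  points := prod_topology (fun i => points (C i)) ;
  chart := forall i, chart (C i) ;
  chart_dom := fun a => [set p | forall i, chart_dom (a i) (p i)] ;
  chart_map := fun a p => \matrix_(i, l) chart_map (a i) (p i) ord0 l ;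
  chart_inv := fun a x i => chart_inv (a i) (row i x) |}.

Lemma box_nbhs (p : product_space) (P : forall i, set (C i)) :
  (forall i, nbhs (p i) (P i)) ->
  nbhs p [set q : product_space | forall i, P i (q i)].
Proof.
move=> Pp.
apply: (@filter_forall _ _
  (fun i => [set q : product_space | P i (q i)]) (nbhs p)).
move=> i; exact: (@proj_continuous _ (fun i => points (C i)) i p _ (Pp i)).
Qed.

Lemma nbhs_box (p : product_space) (Q : set product_space) : nbhs p Q ->
  exists2 P : (forall i, set (C i)), (forall i, nbhs (p i) (P i)) &
    forall q : product_space, (forall i, P i (q i)) -> Q q.
Proof.
pose F := filter_from [set P : forall i, set (C i) | forall i, nbhs (p i) (P i)]
  (fun P => [set q : product_space | forall i, P i (q i)]).
have FF : Filter F.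
  apply: filter_from_filter => [|P P' hP hP'].
    by exists (fun=> setT) => i; exact: filterT.
  exists (fun i => P i `&` P' i) => [i|q Pq]; first exact: filterI.
  by split=> i; have [] := Pq i.
suff Fp : F --> p.
  by move=> /Fp [P Pp PQ]; exists P => // q Pq; exact: PQ.
apply/cvg_sup => i U /= [_ [[V oV <-] /= Vp]] /filterS; apply.
pose P j : set (C j) := [set y | forall e : j = i, V (ecast z (C z) e y)].
exists P => [j|q Pq]; last exact: (Pq i erefl).
have [ji|ji] := pselect (j = i); last first.
  by apply: filterS filterT => y _ e.
case: i / ji V oV Vp @P => V oV Vp P.
have nV : nbhs (p j) V by apply: open_nbhs_nbhs.
by apply: filterS nV => y Vy e; rewrite (eq_axiomK e).
Qed.

Lemma product_open (P : forall i, set (C i)) : (forall i, open (P i)) ->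
  open [set q : product_space | forall i, P i (q i)].
Proof.
move=> oP; rewrite openE => p Pp; apply: box_nbhs => i.
by apply: open_nbhs_nbhs.
Qed.

Lemma product_second_countable : @second_countable product_space.
Proof.
have sc i := mfd_second_countable (manifoldP (C i)).
pose B i := sval (cid2 (sc i)).
have cB i : countable (B i) by rewrite /B; case: cid2.
have bB i : basis (B i) by rewrite /B; case: cid2.
pose f i : set (C i) -> nat := sval (cid (elimT (countable_injP _) (cB i))).
have fI i : {in B i &, injective (f i)} by rewrite /f; case: cid.
pose box (P : forall i, set (C i)) :=
  [set q : product_space | forall i, P i (q i)].
exists [set box P | P in [set P | forall i, B i (P i)]].
  apply: card_le_trans (card_image_le _ _) _.
  apply/countable_injP; exists (fun P => pickle [ffun i => f i (P i)]).
  move=> P P' /set_mem BP /set_mem BP' /(pcan_inj pickleK) /ffunP fP.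
  apply: functional_extensionality_dep => i.
  by apply: (fI i); rewrite ?inE //; have := fP i; rewrite !ffunE.
split=> [_ [P BP <-]|p Q /nbhs_box [P Pp PQ]].
  by apply: product_open => i; exact: (bB i).1 (BP i).
have h i : exists U, (B i U /\ U (p i)) /\ U `<=` P i.
  by have [U] := (bB i).2 (p i) _ (Pp i); exists U.
pose U i := sval (cid (h i)).
have UP i : (B i (U i) /\ U i (p i)) /\ U i `<=` P i by rewrite /U; case: cid.
exists (box U).
  by split=> [|i]; [exists U => // i|]; have [[]] := UP i.
by move=> q Uq; apply: PQ => i; apply: (UP i).2.
Qed.

Let img i (a : chart (C i)) : set 'rV[R]_n := chart_map a @` chart_dom a.

Lemma row_chart_map (a : chart product_space) p i :
  row i (chart_map a p) = chart_map (a i) (p i).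
Proof. by apply/rowP => l; rewrite !mxE. Qed.

Lemma chart_mapK (a : chart product_space) p : chart_dom a p ->
  chart_inv a (chart_map a p) = p.
Proof.
move=> ap; apply: functional_extensionality_dep => i.
by rewrite /chart_inv /= row_chart_map (mfd_mapK (manifoldP (C i)) (ap i)).
Qed.

Lemma image_box (a : chart product_space) (P : forall i, set (C i)) :
  (forall i, P i `<=` chart_dom (a i)) ->
  chart_map a @` [set p | forall i, P i (p i)] =
  [set x | forall i, (chart_map (a i) @` P i) (row i x)].
Proof.
move=> Pa; apply/seteqP; split=> [_ [p Pp <-] i|x hx].
  by exists (p i) => //; rewrite row_chart_map.
pose p i := sval (cid2 (hx i)).
have pP i : P i (p i) /\ chart_map (a i) (p i) = row i x.
  by rewrite /p; case: cid2.
exists p => [i|]; first exact: (pP i).1.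
by apply/row_matrixP => i; rewrite row_chart_map (pP i).2.
Qed.

Lemma rows_open (P : 'I_k -> set 'rV[R]_n) : (forall i, open (P i)) ->
  open [set x : 'M[R]_(k, n) | forall i, P i (row i x)].
Proof.
move=> oP; rewrite openE => x Px.
apply: (@filter_forall _ _ (fun i => [set x | P i (row i x)]) (nbhs x)) => i.
by apply: row_continuous; apply: open_nbhs_nbhs.
Qed.

Lemma product_is_manifold : is_manifold product_space.
Proof.
have mC i := manifoldP (C i).
have imgE (a : chart product_space) :
    chart_map a @` chart_dom a = [set x | forall i, img (a i) (row i x)].
  exact: (@image_box a (fun i => chart_dom (a i)) (fun i => @subset_refl _ _)).
split.
- exact: (@hausdorff_product _ (fun i => points (C i))
    (fun i => mfd_hausdorff (mC i))).
- exact: product_second_countable.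
- move=> p; pose a i := sval (cid (mfd_cover (mC i) (p i))).
  by exists a => i; rewrite /a; case: cid.
- by move=> a; apply: (@product_open (fun i => chart_dom (a i))) => i;
  exact: (mfd_dom_open (mC i)).
- by move=> a; rewrite imgE; apply: (@rows_open (fun i => img (a i))) => i;
  exact: (mfd_image_open (mC i)).
- by move=> a p; exact: chart_mapK.
- move=> a p ap A [P pP PA].
  have pB i : nbhs (p i) [set y | forall l, P i l (chart_map (a i) y ord0 l)].
    have nP : nbhs (chart_map (a i) (p i))
        [set u : 'rV[R]_n | forall l, P i l (u ord0 l)].
      exists (fun _ l => P i l) => [j l|y hy l]; last exact: hy.
      by have := pP i l; rewrite mxE [j]ord1.
    exact: (mfd_map_continuous (mC i) (ap i) nP).
  apply: filterS (box_nbhs pB) => q hq.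
  by apply: PA => i l; rewrite mxE; exact: hq.
- move=> a x; rewrite imgE => hx A /nbhs_box [P pP PA].
  have : forall i, nbhs x [set y | P i (chart_inv (a i) (row i y))].
    move=> i.
    have nP := mfd_inv_continuous (mC i) (hx i) (pP i).
    exact: (row_continuous nP).
  by move=> /filter_forall; apply: filterS => y hy; apply: PA.
move=> a b m.
have DE : chart_dom a `&` chart_dom b =
    [set p : product_space |
      forall i, (chart_dom (a i) `&` chart_dom (b i)) (p i)].
  by apply/seteqP; split=> p => [[ap bp] i|hp]; split=> //= i;
    have [] := hp i.
pose T i := chart_map (a i) @` (chart_dom (a i) `&` chart_dom (b i)).
have oT i : open (T i).
  exact: overlap_open.
have TE : chart_map a @` (chart_dom a `&` chart_dom b) =
    [set x | forall i, T i (row i x)].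
  rewrite DE; apply: (@image_box a
    (fun i => chart_dom (a i) `&` chart_dom (b i))).
  by move=> i p [].
rewrite TE.
have -> : chart_map b \o chart_inv a =
    \sum_i (block i \o ((chart_map (b i) \o chart_inv (a i)) \o row i)).
  apply/funext => x; rewrite fct_sumE [LHS]sum_block.
  by apply: eq_bigr => i _; rewrite row_chart_map.
apply: class_C_sum => [|i]; first exact: rows_open.
apply: class_C_postcomp; [exact: rows_open|exact: block_continuous|].
apply: (@sub_class_C _ _ _ _ _ (row i @^-1` T i)).
  by move=> x; apply.
apply: (class_C_precomp (@row_continuous R k n i)).
exact: (mfd_transition (mC i)).
Qed.

Definition product_manifold : manifold 'M[R]_(k, n) :=
  Manifold product_is_manifold.

End Product.

Section Projections.
Context {R : realType} {k n : nat} (C : 'I_k -> manifold 'rV[R]_n).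
Let M := product_manifold C.

Definition projection (i : 'I_k) : M -> C i := fun p => p i.

(* (pi_i)_* at p, in the product chart [a] and its i-th factor. *)
Definition d_projection (i : 'I_k) (a : chart M) (p : M) :
    'M[R]_(k, n) -> 'rV[R]_n :=
  tangent_map (@projection i) a (a i) p.

Lemma d_projectionE i (a : chart M) p : chart_dom a p ->
  d_projection i a p = row i.
Proof.
move=> ap; have ax : (chart_map a @` chart_dom a) (chart_map a p) by exists p.
have E : \forall y \near chart_map a p, row i y =
    (chart_map (a i) \o @projection i \o chart_inv a) y.
  have := open_nbhs_nbhs (conj (mfd_image_open (manifoldP M) a) ax).
  apply: filterS => _ [q aq <-].
  rewrite -[RHS]/(chart_map (a i) (chart_inv a (chart_map a q) i)).
  by rewrite (mfd_mapK (manifoldP M) aq) row_chart_map.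
have rc : continuous (row i : 'M[R]_(k, n) -> 'rV[R]_n).
  exact: row_continuous.
have dr : differentiable (row i : 'M[R]_(k, n) -> 'rV[R]_n) (chart_map a p).
  exact: linear_differentiable.
have [_ dE] := near_eq_diff E dr.
by rewrite /d_projection /tangent_map dE diff_lin.
Qed.

(* The i-th factor of the splitting TM = D_1 + ... + D_k. *)
Definition factor_distribution (i : 'I_k) : distribution M := fun a p =>
  [set u | forall j, j != i -> d_projection j a p u = 0].

(* [block i u] is the lift of [u]. *)
Lemma lift_unique i (a : chart M) p (u : 'rV[R]_n) (w : 'M[R]_(k, n)) :
  chart_dom a p ->
  (factor_distribution i a p w /\ d_projection i a p w = u) <-> w = block i u.
Proof.
move=> ap; rewrite /factor_distribution /=; split=> [[Dw <-]|->].
  rewrite d_projectionE // [LHS]sum_block (bigD1 i) //= big1 ?addr0 // => j ji.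
  by have := Dw j ji; rewrite d_projectionE // => ->; rewrite linear0.
split=> [j ji|]; rewrite d_projectionE // row_block; last by rewrite eqxx.
by rewrite (negPf ji).
Qed.

Definition lift_vfield i (X : vfield (C i)) : vfield M :=
  fun a p => block i (X (a i) (p i)).

(* T on lifts from C_i, and 0 on D_j for j != i. *)
Definition lift_endo i (T : endo_field (C i)) : endo_field M :=
  fun a p u => block i (T (a i) (p i) (d_projection i a p u)).

Definition proj_pullback_covector i (w : covector_field (C i)) :
    covector_field M :=
  fun a p u => w (a i) (p i) (d_projection i a p u).

Definition proj_pullback_bilinear i (g : bilinear_field (C i)) :
    bilinear_field M :=
  fun a p u v =>
    g (a i) (p i) (d_projection i a p u) (d_projection i a p v).

End Projections.

Section SewedCells.
Context {R : realType}.

Record cell := Cell {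
  cell_manifold :> manifold 'rV[R]_3 ;
  cell_phi : endo_field cell_manifold ;
  cell_xi : vfield cell_manifold ;
  cell_eta : covector_field cell_manifold ;
  cell_g : bilinear_field cell_manifold ;
  cell_acm : almost_contact_metric cell_phi cell_xi cell_eta cell_g ;
  cell_closed : form_eq0 (ext_deriv (form_of_covector cell_eta)) }.

Context {k : nat} (C : 'I_k -> cell).

Definition product_of_cells : manifold 'M[R]_(k, 3) :=
  product_manifold (fun i => cell_manifold (C i)).

Definition canonical_f : endo_field product_of_cells :=
  fun a p u => \sum_i lift_endo (@cell_phi (C i)) a p u.

Definition canonical_g : bilinear_field product_of_cells :=
  fun a p u v => \sum_i proj_pullback_bilinear (@cell_g (C i)) a p u v.

Definition canonical_xi (i : 'I_k) : vfield product_of_cells :=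
  lift_vfield (@cell_xi (C i)).

Definition canonical_eta (i : 'I_k) : covector_field product_of_cells :=
  proj_pullback_covector (@cell_eta (C i)).

Definition median_vfield : vfield product_of_cells :=
  fun a p => (Num.sqrt k%:R)^-1 *: \sum_i canonical_xi i a p.

Definition sewing_distribution : distribution product_of_cells := fun a p =>
  [set u | exists v c, u = canonical_f a p v + c *: median_vfield a p].

Definition sewed_cells (N : manifold 'rV[R]_(2 * k).+1)
    (iota : N -> product_of_cells) :=
  maximal_integral_submanifold sewing_distribution iota.

(* The choice of [i] is immaterial: the iota^* eta_i coincide. *)
Definition sewed_structure (i : 'I_k) (N : manifold 'rV[R]_(2 * k).+1)
    (iota : N -> product_of_cells) (phi : endo_field N) (xi : vfield N)
    (eta : covector_field N) (g : bilinear_field N) :=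
  [/\ restricts_endo iota phi canonical_f,
      restricts_vfield iota xi median_vfield,
      pullback_covector iota eta
        (fun b p u => Num.sqrt k%:R * canonical_eta i b p u) &
      pullback_bilinear iota g canonical_g].

End SewedCells.

Arguments cell R : clear implicits.

(* Main.v *)
(* On a vector f v + c xi of the sewing distribution every eta_i takes the value
   c / sqrt k, because eta_i o phi_i = 0.  This yields the pointwise identities
   on N, and eta = sqrt k iota^* eta_i for every i.  Since d commutes with
   pullbacks, d eta = 0, and eta wedge d Phi is sqrt k times the sum of the
   pullbacks along pi_i o iota of the forms eta_i wedge d Phi_i, which vanish
   because they are 4-forms in dimension 3.  The restrictions of f and xi to N
   are smooth because their inner products with constant vectors are. *)
Require Import Defs.
From HB Require Import structures.
From mathcomp Require Import all_boot all_order all_algebra.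
From mathcomp Require Import all_classical all_reals all_analysis.
From mathcomp Require Import ring.

Set Implicit Arguments.
Unset Strict Implicit.
Unset Printing Implicit Defensive.

Import Order.TTheory GRing.Theory Num.Theory.
Import numFieldNormedType.Exports.
Local Open Scope classical_set_scope.
Local Open Scope ring_scope.

(** * Calculus of maps of class C^n *)

(** Tensors are evaluated on constant coordinate vectors, so d of a pullback acquires second
    derivatives of the coordinate expression of the map. They cancel by the symmetry of second
    derivatives, which is therefore established for [class_C], where only directional derivatives
    are at hand. A restricted field is known only through its image under the injective differential
    of [iota]. That differential is never inverted smoothly: the inner products are computed in [M],
    where every ingredient is smooth, and the Gram matrix of the induced metric is inverted instead.
    The factor sqrt k has two origins. Each [eta_i] takes the value 1 / sqrt k on the median field,
    so sqrt k normalises [eta xi = 1]. On vectors tangent to [N] the k products [eta_i u * eta_i v]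
    coincide, and their sum, which is what [f] takes away from the metric, is k (eta u / sqrt k)
    (eta v / sqrt k) = eta u * eta v. *)

Section Entries.
Context {R : realType} {m n : nat}.

(** [entry] and [single] are packaged as linear maps so that [class_C_postcomp] applies; together
    they reduce smoothness of a matrix-valued map to its entries. *)
Definition entry (i : 'I_m) (j : 'I_n) (A : 'M[R]_(m, n)) : R := A i j.

Fact entry_is_linear i j : linear (entry i j : 'M[R]_(m, n) -> R^o).
Proof. by move=> a A B; rewrite /entry !mxE. Qed.
HB.instance Definition _ i j := GRing.isLinear.Build R 'M[R]_(m, n) R^o _
  (entry i j) (entry_is_linear i j).

Lemma entry_continuous i j : continuous (entry i j).
Proof. exact: coord_continuous. Qed.

Definition single (i : 'I_m) (j : 'I_n) (c : R^o) : 'M[R]_(m, n) :=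
  (c : R) *: delta_mx i j.

Fact single_is_linear i j : linear (single i j).
Proof. by move=> a c d; rewrite /single scalerDl scalerA. Qed.
HB.instance Definition _ i j := GRing.isLinear.Build R R^o 'M[R]_(m, n) _
  (single i j) (single_is_linear i j).

Lemma single_continuous i j : continuous (single i j).
Proof. exact: scalel_continuous. Qed.

End Entries.

Section Calculus.
Context {R : realType}.
Implicit Types V W : normedModType R.

Lemma open_nearT V (U : set V) x (P : V -> Prop) : open U -> U x ->
  (forall y, U y -> P y) -> \forall y \near x, P y.
Proof.
by move=> oU Ux UP; apply: filterS (open_nbhs_nbhs (conj oU Ux)).
Qed.

Lemma class_CW n V W (U : set V) (f : V -> W) :
  class_C n.+1 U f -> class_C n U f.
Proof.
elim: n f => [|n IH] f [df Df].
  by move=> x Ux; apply: differentiable_continuous; exact: df.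
by split=> // v; exact/IH/Df.
Qed.

Lemma class_C_cst n V W (U : set V) (c : W) : class_C n U (fun=> c).
Proof.
case: n => [x _|n]; first exact: cst_continuous.
split=> [x _|v]; first exact: differentiable_cst.
rewrite (_ : 'D_v _ = 0); first exact: class_C0.
by apply/funext => x; exact: derive_cst.
Qed.

Lemma class_C_id n V (U : set V) : class_C n U id.
Proof.
case: n => [x _|n]; first exact: cvg_id.
split=> [x _|v]; first exact: ex_diff.
rewrite (_ : 'D_v id = fun=> v); first exact: class_C_cst.
by apply/funext => x; exact: derive_id.
Qed.

Lemma class_CM n V (U : set V) (f g : V -> R) : open U ->
  class_C n U f -> class_C n U g -> class_C n U (fun x => f x * g x).
Proof.
move=> oU; elim: n f g => [|n IH] f g Cf Cg.
  by move=> x Ux; apply: continuousM; [exact: Cf|exact: Cg].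
have [[df Df] [dg Dg]] := (Cf, Cg).
split=> [x Ux|v]; first exact: (differentiableM (df x Ux) (dg x Ux)).
have Dfg := class_CD oU (IH _ _ (class_CW Cf) (Dg v))
  (IH _ _ (class_CW Cg) (Df v)).
apply: eq_class_C Dfg => // x Ux.
by rewrite (deriveM (diff_derivable (df x Ux)) (diff_derivable (dg x Ux))).
Qed.

(** The derivative of the inverse is [- f^-1 * f^-1 * 'D_v f], so the induction hypothesis is used
    on the inverse itself. *)
Lemma class_CV n V (U : set V) (f : V -> R) : open U ->
  (forall x, U x -> f x != 0) ->
  class_C n U f -> class_C n U (fun x => (f x)^-1).
Proof.
move=> oU f0; elim: n => [|n IH] Cf.
  by move=> x Ux; apply: continuousV; [exact: f0|exact: Cf].
have [df Df] := Cf; split=> [x Ux|v].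
  by apply: differentiableV; [exact: df|exact: f0].
have IHf := IH (class_CW Cf).
have D := class_CM oU (class_CM oU (class_C_cst n U (- 1 : R))
  (class_CM oU IHf IHf)) (Df v).
apply: eq_class_C D => // x Ux.
rewrite deriveV; [|exact: f0|exact/diff_derivable/df].
by rewrite -[RHS]/(- (f x ^+ 2)^-1 * _) expr2 invfM mulN1r.
Qed.

Lemma class_C_bigsum n V W (U : set V) (I : Type) (r : seq I) (P : pred I)
    (f : I -> V -> W) : open U ->
  (forall i, P i -> class_C n U (f i)) ->
  class_C n U (fun x => \sum_(i <- r | P i) f i x).
Proof.
move=> oU Cf; rewrite (_ : (fun _ => _) = \sum_(i <- r | P i) f i).
  by elim/big_ind: _ => // [|g h]; [exact: class_C0|exact: class_CD].
by apply/funext => x; rewrite fct_sumE.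
Qed.

Lemma class_C_prod n V (U : set V) (I : Type) (r : seq I) (P : pred I)
    (f : I -> V -> R) : open U ->
  (forall i, P i -> class_C n U (f i)) ->
  class_C n U (fun x => \prod_(i <- r | P i) f i x).
Proof.
move=> oU Cf; rewrite (_ : (fun _ => _) =
    \big[(fun g h x => g x * h x)/(fun=> 1)]_(i <- r | P i) f i).
  by elim/big_ind: _ => // [|g h]; [exact: class_C_cst|exact: class_CM].
by apply/funext => x; elim/big_rec2: _ => // i g y _ ->.
Qed.

Lemma class_C_entry n V p q (U : set V) (f : V -> 'M[R]_(p, q)) i j :
  open U -> class_C n U f -> class_C n U (fun x => f x i j : R).
Proof.
move=> oU Cf.
exact: (class_C_postcomp (L := entry i j) oU (@entry_continuous _ _ _ i j) Cf).
Qed.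

Lemma class_C_mx n V p q (U : set V) (f : V -> 'M[R]_(p, q)) : open U ->
  (forall i j, class_C n U (fun x => f x i j : R)) -> class_C n U f.
Proof.
move=> oU Cf.
suff -> : f = fun x => \sum_i \sum_j single i j (f x i j).
  apply: class_C_bigsum => // i _; apply: class_C_bigsum => // j _.
  exact: (class_C_postcomp oU (@single_continuous _ _ _ i j) (Cf i j)).
by apply/funext => x; exact: matrix_sum_delta.
Qed.

(** Linearity is taken as a proposition because tensor components are linear only at points of a
    chart domain; a linear structure is packed locally. *)
Lemma linear_mx_sum p q W (L : 'M[R]_(p, q) -> W) A : linear L ->
  L A = \sum_i \sum_j A i j *: L (delta_mx i j).
Proof.
move=> Ll; pose L' := HB.pack_for {linear 'M[R]_(p, q) -> W} L
  (GRing.isLinear.Build R 'M[R]_(p, q) W _ L Ll).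
rewrite -[L]/(L' : _ -> _) {1}(matrix_sum_delta A) linear_sum.
apply: eq_bigr => i _; rewrite linear_sum; apply: eq_bigr => j _.
by rewrite linearZ.
Qed.

(** The direction ['D_v f x] in the chain rule varies with [x], whereas [class_C] speaks of fixed
    directions. Expanding it in the basis [delta_mx i j] leaves derivatives of [g] in fixed
    directions, to which the induction applies. *)
Lemma class_C_comp n V p q (U : set V) (U' : set 'M[R]_(p, q))
    (f : V -> 'M[R]_(p, q)) (g : 'M[R]_(p, q) -> R) : open U -> open U' ->
  (forall x, U x -> U' (f x)) ->
  class_C n U f -> class_C n U' g -> class_C n U (g \o f).
Proof.
move=> oU oU' fU; elim: n g => [|n IH] g Cf Cg.
  move=> x Ux; apply: continuous_comp; first exact: Cf.
  exact/Cg/fU.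
have [[df Df] [dg Dg]] := (Cf, Cg); split=> [x Ux|v].
  by apply: differentiable_comp; [exact: df|exact/dg/fU].
apply: (eq_class_C oU (f := fun x => \sum_i \sum_j
    ('D_v f x i j * 'D_(delta_mx i j) g (f x)))) => [x Ux|].
  have [dfx dgx] := (df x Ux, dg (f x) (fU x Ux)).
  rewrite [RHS]deriveE; last exact: differentiable_comp.
  rewrite (diff_comp dfx dgx) /= -(deriveE v dfx).
  rewrite [RHS](@linear_mx_sum _ _ R^o ('d g (f x)) _ (linearP _)).
  by apply: eq_bigr => i _; apply: eq_bigr => j _; rewrite (deriveE _ dgx).
apply: class_C_bigsum => // i _; apply: class_C_bigsum => // j _.
apply: class_CM => //; first exact: (class_C_entry i j oU (Df v)).
exact: (IH ('D_(delta_mx i j) g) (class_CW Cf) (Dg _)).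
Qed.

(** Derivatives are total functions that do not depend on [U], so [class_C] is a condition point by
    point. *)
Lemma class_C_local n V W (U : set V) (f : V -> W) :
  (forall x, U x -> exists U', [/\ open U', U' x & class_C n U' f]) ->
  class_C n U f.
Proof.
elim: n f => [|n IH] f loc.
  by move=> x /loc [U' [oU' Ux]]; exact.
split=> [x /loc [U' [oU' Ux [df _]]]|v]; first exact: df.
by apply: IH => x /loc [U' [oU' Ux [_ Df]]]; exists U'; split=> //; exact: Df.
Qed.

(** Tensor components are known to be smooth on constant vectors only; expanding [G x] in a basis
    extends this to variable ones. *)
Lemma class_C_linear_arg n V p q (U : set V)
    (Q : V -> 'M[R]_(p, q) -> R) (G : V -> 'M[R]_(p, q)) : open U ->
  (forall x, U x -> scalar (Q x)) ->
  (forall z, class_C n U (Q^~ z)) -> class_C n U G ->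
  class_C n U (fun x => Q x (G x)).
Proof.
move=> oU Ql CQ CG.
apply: (eq_class_C oU (f := fun x => \sum_i \sum_j
    (G x i j * Q x (delta_mx i j)))) => [x Ux|].
  by rewrite (@linear_mx_sum _ _ R^o (Q x) (G x)) //; exact: Ql.
apply: class_C_bigsum => // i _; apply: class_C_bigsum => // j _.
by apply: class_CM => //; exact: (class_C_entry i j oU CG).
Qed.

(* The ascriptions [_ : R] below select the addition of the field [R]; without
   them elaboration picks the one of [R] as a normed module over itself. *)
Lemma derive_linear_arg V p q (Q : V -> 'M[R]_(p, q) -> R)
    (G : V -> 'M[R]_(p, q)) u x :
  (\forall y \near x, scalar (Q y)) ->
  (forall z, derivable (Q^~ z) x u) -> derivable G x u ->
  derivable (fun y => Q y (G y)) x u /\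
  'D_u (fun y => Q y (G y)) x = ('D_u (Q^~ (G x)) x : R) + Q x ('D_u G x).
Proof.
move=> Ql dQ dG.
have dGij i j : derivable (fun y => G y i j) x u.
  exact: (derivable_mxP G x u).1.
(* Stated for an arbitrary [H]: it serves for [G] and for the constant [G x], and the two
   derivatives differ by [Q x ('D_u G x)]. *)
have QE (H : V -> 'M[R]_(p, q)) : \forall y \near x, Q y (H y) =
    (\sum_i \sum_j (fun y => H y i j : R) * (Q^~ (delta_mx i j))) y.
  apply: filterS Ql => y Qy; rewrite (@linear_mx_sum _ _ R^o (Q y) (H y)) //.
  by rewrite fct_sumE; apply: eq_bigr => i _; rewrite fct_sumE.
have dH (H : V -> 'M[R]_(p, q)) :
    (forall i j, derivable (fun y => H y i j) x u) ->
    derivable (\sum_i \sum_j (fun y => H y i j : R) * (Q^~ (delta_mx i j)))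
      x u /\
    'D_u (\sum_i \sum_j (fun y => H y i j : R) * (Q^~ (delta_mx i j))) x =
    \sum_i \sum_j (H x i j * 'D_u (Q^~ (delta_mx i j)) x +
      Q x (delta_mx i j) * 'D_u (fun y => H y i j : R) x).
  move=> dHij; have d1 i j :
      derivable ((fun y => H y i j : R) * (Q^~ (delta_mx i j))) x u.
    by apply: derivableM => //; exact: dHij.
  split.
    by apply: derivable_sum => i; apply: derivable_sum => j; exact: d1.
  rewrite derive_sum; last by move=> i; apply: derivable_sum => j; exact: d1.
  apply: eq_bigr => i _; rewrite derive_sum //.
  apply: eq_bigr => j _; rewrite deriveM //; exact: dHij.
have [dS DS] := dH G dGij; split.
  apply: (near_eq_derivable _ dS).
  by apply: filterS (QE G) => y ->.
rewrite (near_eq_derive u (QE G)) DS.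
rewrite (near_eq_derive u (QE (fun=> G x))) (dH (fun=> G x) _).2; last first.
  by move=> i j; exact: derivable_cst.
rewrite [Q x ('D_u G x)](@linear_mx_sum _ _ R^o (Q x) _); last first.
  exact: nbhs_singleton Ql.
rewrite -big_split; apply: eq_bigr => i _; rewrite -big_split.
apply: eq_bigr => j _ /=; rewrite (derive_cst (G x i j)) mulr0 addr0.
by congr (_ + _); rewrite mulrC derive_mx // mxE.
Qed.

End Calculus.

(** * Symmetry of second derivatives *)

Section Schwarz.
Context {R : realType}.
Implicit Types V W : normedModType R.

Lemma is_derive_line V (f : V -> R) (x v : V) (s : R) :
  differentiable f (x + s *: v) ->
  is_derive s 1 (fun t : R => f (x + t *: v)) ('D_v f (x + s *: v)).
Proof.
move=> df.
have E : (fun h : R => h^-1 *: (((fun t : R => f (x + t *: v)) \o shift s)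
      (h *: (1 : R)) - f (x + s *: v))) =
    (fun h : R =>
      h^-1 *: ((f \o shift (x + s *: v)) (h *: v) - f (x + s *: v))).
  apply/funext => h /=; congr (_ *: (f _ - _)).
  by rewrite scalerDl -[h *: 1]/(h * 1) mulr1 addrCA addrA.
split; last by rewrite /derive E.
by rewrite /derivable E; exact: diff_derivable.
Qed.

Lemma MVT_line V (f : V -> R) (x v : V) (t : R) : 0 < t ->
  (forall s, 0 <= s <= t -> differentiable f (x + s *: v)) ->
  exists2 c, 0 <= c <= t & f (x + t *: v) - f x = 'D_v f (x + c *: v) * t.
Proof.
move=> t0 df.
have dfl s : 0 <= s <= t -> is_derive s 1 (fun r : R => f (x + r *: v))
    ('D_v f (x + s *: v)) by move=> /df; exact: is_derive_line.
have [s| |c] := @MVT R (fun s : R => f (x + s *: v))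
    (fun s => 'D_v f (x + s *: v)) 0 t t0.
- by rewrite in_itv => /andP [s0 st]; apply: dfl; rewrite !ltW.
- apply: derivable_within_continuous => s; rewrite in_itv => /dfl.
  by case.
rewrite in_itv => /andP [c0 ct].
by rewrite scale0r addr0 subr0 => E; exists c; rewrite ?(ltW c0) ?(ltW ct).
Qed.

Lemma diff_shift V (f : V -> R) (w x : V) : differentiable f (x + w) ->
  differentiable (fun y => f (y + w)) x /\
  forall u, 'D_u (fun y => f (y + w)) x = 'D_u f (x + w).
Proof.
move=> df; split=> [|u].
  rewrite -[fun _ => _]/(f \o (fun y => y + w)).
  exact: differentiable_comp.
by rewrite /derive; under eq_fun do rewrite /= -addrA.
Qed.

Definition second_difference V (f : V -> R) (x u v : V) (h : R) :=
  f (x + h *: u + h *: v) - f (x + h *: u) - f (x + h *: v) + f x.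

(* The mean value theorem is applied first along [u], to the difference of [f]
   at [y + h *: v] and at [y], and then along [v], to ['D_u f]. *)
Lemma second_difference_near V (U : set V) (f : V -> R) (x u v : V) (e : R) :
  open U -> U x -> class_C 2 U f -> 0 < e ->
  exists2 d, 0 < d & forall h, 0 < h < d ->
    `|second_difference f x u v h / h ^+ 2 - 'D_v ('D_u f) x| < e.
Proof.
move=> oU Ux [df /(_ u) [dDf /(_ v) DDf]] e0.
have /nbhs_ballP [d /= d0 dE] : \forall y \near x,
    U y /\ `|'D_v ('D_u f) x - 'D_v ('D_u f) y| < e.
  near=> y; split; near: y; first exact: open_nbhs_nbhs.
  by move/cvgr_dist_lt : (DDf x Ux); exact.
(* The displacements considered have norm at most [h * r]; the added 1 keeps [r] positive when [u]
   and [v] vanish. *)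
pose r := `|u| + `|v| + 1.
have r0 : 0 < r by rewrite /r ltr_wpDl.
exists (d / r) => [|h /andP [h0 hd]]; first exact: divr_gt0.
have near_x a b : 0 <= a <= h -> 0 <= b <= h ->
    U (x + a *: u + b *: v) /\
    `|'D_v ('D_u f) x - 'D_v ('D_u f) (x + a *: u + b *: v)| < e.
  move=> /andP [a0 ah] /andP [b0 bh]; apply: dE.
  rewrite -ball_normE /ball_ /= -addrA opprD addNKr normrN.
  apply: (@le_lt_trans _ _ (h * r)); last by rewrite -ltr_pdivlMr.
  rewrite (le_trans (ler_normD _ _)) // !normrZ (ger0_norm a0) (ger0_norm b0).
  rewrite /r !mulrDr mulr1 ler_wpDr ?(ltW h0) //.
  by apply: lerD; apply: ler_wpM2r.
have h00 : 0 <= (0 : R) <= h by apply/andP; split=> //; exact: ltW.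
have hh : 0 <= h <= h by apply/andP; split=> //; exact: ltW.
have [s hs|c hc] := @MVT_line V (fun y => f (y + h *: v) - f y) x u h h0.
  have Us := (near_x s h hs hh).1; have Us' := (near_x s 0 hs h00).1.
  rewrite scale0r addr0 in Us'.
  by apply: differentiableB; [exact: (diff_shift (df _ Us)).1|exact: df].
have Uc := (near_x c h hc hh).1; have Uc' := (near_x c 0 hc h00).1.
rewrite scale0r addr0 in Uc'.
rewrite (_ : 'D_u _ _ = 'D_u f (x + c *: u + h *: v) - 'D_u f (x + c *: u));
    last first.
  have [d1 D1] := diff_shift (df _ Uc).
  by rewrite (deriveB (diff_derivable d1) (diff_derivable (df _ Uc'))) D1.
have [s hs|b hb] := @MVT_line V ('D_u f) (x + c *: u) v h h0.
  exact/dDf/(near_x c s hc hs).1.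
move=> -> E.
have -> : second_difference f x u v h / h ^+ 2 =
    'D_v ('D_u f) (x + c *: u + b *: v).
  have h1 : h != 0 by rewrite gt_eqF.
  apply: (mulIf (expf_neq0 2 h1)); rewrite divfK ?expf_neq0 // expr2 mulrA -E.
  by rewrite /second_difference /= opprB addrA addrAC.
by rewrite distrC; exact: (near_x c b hc hb).2.
Unshelve. all: by end_near. Qed.

Lemma second_differenceC V (f : V -> R) (x u v : V) (h : R) :
  second_difference f x u v h = second_difference f x v u h.
Proof.
by rewrite /second_difference [x + h *: u + _]addrAC [f _ - _ - _]addrAC.
Qed.

(** The second difference is symmetric in [u] and [v], so its quotient approximates both iterated
    derivatives; a precision of half their distance is contradictory. *)
Lemma derive_swap_real V (U : set V) (f : V -> R) (x u v : V) :
  open U -> U x -> class_C 2 U f -> 'D_v ('D_u f) x = 'D_u ('D_v f) x.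
Proof.
move=> oU Ux Cf; apply/eqP; rewrite -subr_eq0; apply/eqP.
apply/eqP/negPn/negP => ne.
pose e := `|'D_v ('D_u f) x - 'D_u ('D_v f) x| / 2.
have e0 : 0 < e by rewrite divr_gt0 // normr_gt0.
have [d1 d10 H1] := second_difference_near u v oU Ux Cf e0.
have [d2 d20 H2] := second_difference_near v u oU Ux Cf e0.
pose h := Num.min d1 d2 / 2.
have h0 : 0 < h by rewrite divr_gt0 // lt_min d10.
have hm : h < Num.min d1 d2.
  by rewrite ltr_pdivrMr // ltr_pMr ?lt_min ?d10 // ltrDl.
move: hm; rewrite lt_min => /andP [hd1 hd2].
have := H1 h; rewrite h0 hd1 => /(_ isT).
have := H2 h; rewrite h0 hd2 => /(_ isT).
rewrite second_differenceC; set q := _ / _ => q2 q1.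
suff : `|'D_v ('D_u f) x - 'D_u ('D_v f) x| < e + e by rewrite /e -splitr ltxx.
rewrite -(subrKA q) (le_lt_trans (ler_normD _ _)) //.
by apply: ltrD; [rewrite distrC; exact: q1|exact: q2].
Qed.

Lemma derive_entry V p q (f : V -> 'M[R]_(p, q)) u x i j : derivable f x u ->
  ('D_u f x) i j = 'D_u (fun y => f y i j : R) x.
Proof. by move=> df; rewrite derive_mx // mxE. Qed.

Lemma derive_swap V p q (U : set V) (f : V -> 'M[R]_(p, q)) (x u v : V) :
  open U -> U x -> class_C 2 U f -> 'D_v ('D_u f) x = 'D_u ('D_v f) x.
Proof.
move=> oU Ux Cf; have [df Df] := Cf.
have dDf w y : U y -> differentiable ('D_w f) y by case: (Df w) => + _; exact.
have E w w' i j : ('D_w' ('D_w f) x) i j =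
    'D_w' ('D_w (fun y => f y i j : R)) x.
  rewrite derive_entry; last exact/diff_derivable/dDf.
  apply: near_eq_derive; apply: (open_nearT oU Ux) => y Uy.
  by rewrite derive_entry //; exact/diff_derivable/df.
apply/matrixP => i j.
have := E u v i j; have := E v u i j.
by have := derive_swap_real u v oU Ux (class_C_entry i j oU Cf); move=> -> <-.
Qed.

End Schwarz.

(** * Pullbacks and the exterior derivative *)

Fact addrDB (V : zmodType) (a b c : V) : (a + c) - (b + c) = a - b.
Proof. by rewrite opprD addrACA subrr addr0. Qed.

(** With [b] a 2-form, [G] the first and [S] the second derivative of a map, these are the
    second-order terms in d of the pulled back form. Each pair of indices occurs twice, with
    cancelling contributions. *)
Fact alternating_sum3 (K : comNzRingType) (T T' : Type) (b : T' -> T' -> K)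
    (G : T -> T') (S : T -> T -> T') (z : 'I_3 -> T) :
  (forall u v, b u v = - b v u) -> (forall u v, S u v = S v u) ->
  \sum_(i < 3) (-1) ^+ i *
    (b (S (z i) (z (lift i ord0))) (G (z (lift i ord_max))) +
     b (G (z (lift i ord0))) (S (z i) (z (lift i ord_max)))) = 0.
Proof.
move=> bN SC; rewrite !big_ord_recl big_ord0.
have -> : lift ord0 (lift ord0 ord0) = ord_max :> 'I_3 by apply: val_inj.
have -> : lift ord0 (ord_max : 'I_2) = ord_max :> 'I_3 by apply: val_inj.
have -> : lift (lift ord0 ord0) (ord0 : 'I_2) = ord0 :> 'I_3 by apply: val_inj.
have -> : lift (lift ord0 ord0) (ord_max : 'I_2) = ord_max :> 'I_3.
  exact: val_inj.
have -> : lift (ord_max : 'I_3) (ord0 : 'I_2) = ord0 :> 'I_3 by apply: val_inj.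
have -> : lift (ord_max : 'I_3) (ord_max : 'I_2) = lift ord0 ord0 :> 'I_3.
  exact: val_inj.
set v0 := z ord0; set v1 := z (lift _ _); set v2 := z ord_max.
(* Only the two terms with [S v0 v2] sit in different slots of [b] and require skewness; the others
   cancel by symmetry of [S]. *)
rewrite (SC v1 v0) (SC v2 v0) (SC v2 v1) (bN (G v1) (S v0 v2)) /= /bump /=.
by ring.
Qed.

Fact eq_signed_sum (K : pzRingType) n (A B C : 'I_n -> K) :
  (forall i, A i = B i + C i) -> \sum_(i < n) (-1) ^+ i * C i = 0 ->
  \sum_(i < n) (-1) ^+ i * A i = \sum_(i < n) (-1) ^+ i * B i.
Proof.
move=> AE C0; under eq_bigr do rewrite AE mulrDr.
by rewrite big_split /= C0 addr0.
Qed.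

Section Pullback.
Context {R : realType} {V : normedModType R} {p q : nat}.
Let E := 'M[R]_(p, q).
Variables (U : set V) (F : V -> E) (x : V) (U' : set E).
Hypotheses (oU : open U) (Ux : U x) (CF : class_C 2 U F).
Hypotheses (oU' : open U') (U'Fx : U' (F x)).

Lemma derive_chain (g : E -> R) u : differentiable g (F x) ->
  derivable (g \o F) x u /\ 'D_u (g \o F) x = 'D_('D_u F x) g (F x).
Proof.
have [/(_ _ Ux) dF _] := CF; move=> dg.
have dgF := differentiable_comp dF dg.
split; first exact: diff_derivable.
by rewrite !deriveE // (diff_comp dF dg).
Qed.

Lemma near_image : \forall y \near x, U' (F y).
Proof.
have [/(_ _ Ux) dF _] := CF.
exact: (differentiable_continuous dF (open_nbhs_nbhs (conj oU' U'Fx))).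
Qed.

Lemma derivable_derive u v : derivable ('D_v F) x u.
Proof. by have [_ /(_ v) [dDF _]] := CF; exact/diff_derivable/dDF. Qed.

Lemma derive_pullback1 (w : E -> E -> R) u v :
  (forall y, U' y -> scalar (w y)) ->
  (forall z, differentiable (w^~ z) (F x)) ->
  derivable (fun y => w (F y) ('D_v F y)) x u /\
  'D_u (fun y => w (F y) ('D_v F y)) x =
  ('D_('D_u F x) (w^~ ('D_v F x)) (F x) : R) + w (F x) ('D_u ('D_v F) x).
Proof.
move=> wl dw.
have [|||d1 ->] := @derive_linear_arg R V p q (fun y => w (F y)) ('D_v F) u x.
- by apply: filterS near_image => y; exact: wl.
- by move=> z; exact: (derive_chain u (dw z)).1.
- exact: derivable_derive.
by split=> //; rewrite (derive_chain u (dw _)).2.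
Qed.

(** Naturality of d on 1-forms: the terms in which [w (F x)] is applied to a second derivative agree
    by [derive_swap] and drop out. *)
Lemma ext_deriv_pullback1 (w : E -> E -> R) u v :
  (forall y, U' y -> scalar (w y)) ->
  (forall z, differentiable (w^~ z) (F x)) ->
  ('D_u (fun y => w (F y) ('D_v F y)) x : R) -
    'D_v (fun y => w (F y) ('D_u F y)) x =
  ('D_('D_u F x) (w^~ ('D_v F x)) (F x) : R) -
    'D_('D_v F x) (w^~ ('D_u F x)) (F x).
Proof.
move=> wl dw; rewrite (derive_pullback1 u v wl dw).2.
rewrite (derive_pullback1 v u wl dw).2 (derive_swap u v oU Ux CF).
by apply: addrDB.
Qed.

Lemma derive_pullback2 (w : E -> E -> E -> R) u v t :
  (forall y z, U' y -> scalar (w y z)) ->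
  (forall y z, U' y -> scalar (w y ^~ z)) ->
  (forall z z', differentiable (fun y => w y z z') (F x)) ->
  derivable (fun y => w (F y) ('D_v F y) ('D_t F y)) x u /\
  'D_u (fun y => w (F y) ('D_v F y) ('D_t F y)) x =
  ('D_('D_u F x) (fun y => w y ('D_v F x) ('D_t F x)) (F x) : R) +
  (w (F x) ('D_u ('D_v F) x) ('D_t F x) + w (F x) ('D_v F x) ('D_u ('D_t F) x)).
Proof.
move=> wlr wll dw.
(* The product rule in the first slot, with the second one frozen at [z]; this supplies the
   derivability required for the second slot. *)
have H z : derivable (fun y => w (F y) ('D_v F y) z) x u /\
    'D_u (fun y => w (F y) ('D_v F y) z) x =
    ('D_('D_u F x) (fun y => w y ('D_v F x) z) (F x) : R) +
    w (F x) ('D_u ('D_v F) x) z.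
  have [|||d1 D1] := @derive_linear_arg R V p q (fun y => w (F y) ^~ z)
    ('D_v F) u x.
  - by apply: filterS near_image => y; exact: wll.
  - by move=> z'; exact: (derive_chain u (dw z' z)).1.
  - exact: derivable_derive.
  by rewrite D1 (derive_chain u (dw _ _)).2.
have [|||d2 D2] := @derive_linear_arg R V p q
    (fun y => w (F y) ('D_v F y)) ('D_t F) u x.
- by apply: filterS near_image => y; exact: wlr.
- by move=> z; exact: (H z).1.
- exact: derivable_derive.
by rewrite D2 (H _).2 addrA.
Qed.

(** Naturality of d on 2-forms. The arguments [z (lift i ord0)] and [z (lift i ord_max)] are those
    left after omitting [z i], as in [ext_deriv]. *)
Lemma ext_deriv_pullback2 (w : E -> E -> E -> R) (z : 'I_3 -> V) :
  (forall y u, U' y -> scalar (w y u)) ->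
  (forall y u v, U' y -> w y u v = - w y v u) ->
  (forall u v, differentiable (fun y => w y u v) (F x)) ->
  \sum_(i < 3) (-1) ^+ i * 'D_(z i) (fun y =>
    w (F y) ('D_(z (lift i ord0)) F y) ('D_(z (lift i ord_max)) F y)) x =
  \sum_(i < 3) (-1) ^+ i * 'D_('D_(z i) F x) (fun y =>
    w y ('D_(z (lift i ord0)) F x) ('D_(z (lift i ord_max)) F x)) (F x).
Proof.
move=> wl wN dw.
have wll y u : U' y -> scalar (w y ^~ u).
  by move=> Uy a v v'; rewrite !(wN y _ u) // wl // opprD mulrN.
have D (i : 'I_3) := (derive_pullback2 (z i) (z (lift i ord0))
  (z (lift i ord_max)) wl wll dw).2.
apply: (eq_signed_sum D).
apply: (@alternating_sum3 R V E (w (F x)) (fun u => 'D_u F x)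
  (fun u v => 'D_u ('D_v F) x)) => u v; first exact: wN.
exact: (derive_swap v u oU Ux CF).
Qed.

End Pullback.

(** * Vanishing of 4-forms in dimension three *)

Lemma sum_I3 (R : nmodType) (F : 'I_3 -> R) :
  \sum_i F i = F ord0 + F (inord 1) + F (inord 2).
Proof.
rewrite !big_ord_recl big_ord0 addr0 addrA.
by congr (_ + F _ + F _); apply: val_inj; rewrite /= inordK.
Qed.

(** The general alternating bilinear form on a space of dimension 3; [c] lists its values on the
    pairs of basis vectors (0,1), (0,2), (1,2). *)
Definition minors (K : pzRingType) (c : nat -> K) (v w : 'rV[K]_3) : K :=
  (v ord0 (inord 0) * w ord0 (inord 1) - v ord0 (inord 1) * w ord0 (inord 0)) *
    c 0%N +
  (v ord0 (inord 0) * w ord0 (inord 2) - v ord0 (inord 2) * w ord0 (inord 0)) *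
    c 1%N +
  (v ord0 (inord 1) * w ord0 (inord 2) - v ord0 (inord 2) * w ord0 (inord 1)) *
    c 2%N.

(* The wedge of a covector with a 3-form is a 4-form, hence 0 in dimension 3. *)
Lemma wedge_dim3 (R : realType) (a : 'rV[R]_3 -> R)
    (T : 'rV[R]_3 -> 'rV[R]_3 -> 'rV[R]_3 -> R) (z : 'I_4 -> 'rV[R]_3) :
  scalar a -> (forall v w, scalar (fun u => T u v w)) ->
  (forall u w, scalar (fun v => T u v w)) ->
  (forall u v w, T u v w = - T u w v) ->
  \sum_(i < 4) (-1) ^+ i * (a (z i) * \sum_(j < 3) (-1) ^+ j *
    T (z (lift i j)) (z (lift i (lift j ord0)))
      (z (lift i (lift j ord_max)))) = 0.
Proof.
move=> al Tl Tl2 TN.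
pose e n : 'rV[R]_3 := delta_mx ord0 (inord n).
have lin (f : 'rV[R]_3 -> R) (u : 'rV[R]_3) : scalar f ->
    f u = u ord0 (inord 0) * f (e 0%N) + u ord0 (inord 1) * f (e 1%N) +
          u ord0 (inord 2) * f (e 2%N).
  move=> fl; rewrite (@linear_mx_sum _ _ _ R^o f) // big_ord1 sum_I3.
  by rewrite (_ : ord0 = inord 0 :> 'I_3) //; apply: val_inj; rewrite /= inordK.
have TD u v : T u v v = 0.
  apply/eqP; have /eqP := TN u v v.
  by rewrite -subr_eq0 opprK -mulr2n mulrn_eq0.
have Tl3 u v : scalar (T u v).
  by move=> c w w'; rewrite !(TN u v) Tl2 opprD mulrN.
have [c TE] : exists c : nat -> nat -> R, forall u v w, T u v w =
    u ord0 (inord 0) * minors (c 0%N) v w +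
    u ord0 (inord 1) * minors (c 1%N) v w +
    u ord0 (inord 2) * minors (c 2%N) v w.
  (* Through the coercion of booleans, [m] = 0, 1, 2 encodes the pairs (0,1), (0,2), (1,2), in the
     order of [minors]. *)
  exists (fun l m => T (e l) (e (m == 2)) (e (m > 0).+1)) => u v w.
  rewrite (lin _ u (Tl v w)); suff T2 l : T (e l) v w =
      minors (fun m => T (e l) (e (m == 2)) (e (m > 0).+1)) v w by rewrite -!T2.
  rewrite (lin _ v (Tl2 (e l) w)) !(lin _ w (Tl3 (e l) _)) !TD.
  rewrite (TN _ (e 1%N) (e 0%N)) (TN _ (e 2%N) (e 0%N)) (TN _ (e 2%N) (e 1%N)).
  by rewrite /minors /=; ring.
have [b aE] : exists b : nat -> R, forall u, a u =
    u ord0 (inord 0) * b 0%N + u ord0 (inord 1) * b 1%N +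
    u ord0 (inord 2) * b 2%N.
  by exists (fun n => a (e n)) => u; exact: lin.
(* Indexing by [nat] lets the nested [lift]s compute, so equal vectors become syntactically equal;
   what remains is a polynomial identity in the coordinates. *)
pose zz n : 'rV[R]_3 := z (inord n).
have zE i : z i = zz i by rewrite /zz inord_val.
rewrite !big_ord_recl !big_ord0 !zE /= /bump /= {zE} !TE !aE /minors.
by ring.
Qed.

(** * Tensor fields along an immersion *)

Section Charts.
Context {R : realType}.

Definition coord_rep (V W : normedModType R) (M : charted_space V)
    (N : charted_space W) (F : M -> N) (a : chart M) (b : chart N) : V -> W :=
  chart_map b \o F \o chart_inv a.

Definition coord_dom (V W : normedModType R) (M : charted_space V)
    (N : charted_space W) (F : M -> N) (a : chart M) (b : chart N) : set V :=
  chart_map a @` (chart_dom a `&` F @^-1` chart_dom b).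

Implicit Types V W : normedModType R.

Lemma coord_dom_open V W (M : manifold V) (N : manifold W) (F : M -> N) a b :
  continuous F -> open (coord_dom F a b).
Proof.
have [mM mN] := (manifoldP M, manifoldP N); move=> cF.
rewrite openE => _ [p [ap bp] <-]; rewrite /interior.
have imgp : (chart_map a @` chart_dom a) (chart_map a p) by exists p.
have nb : nbhs (chart_inv a (chart_map a p)) (F @^-1` chart_dom b).
  rewrite (mfd_mapK mM ap); apply: cF.
  by apply: open_nbhs_nbhs; split=> //; exact: mfd_dom_open.
have := mfd_inv_continuous mM imgp nb.
apply: filterS2 (open_nbhs_nbhs (conj (mfd_image_open mM a) imgp)).
move=> _ [q aq <-] bq; exists q => //; split=> //.
by rewrite /preimage /= -(mfd_mapK mM aq).
Qed.

Lemma coord_domP V W (M : manifold V) (N : manifold W) (F : M -> N) a b x :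
  coord_dom F a b x -> [/\ chart_dom a (chart_inv a x),
    chart_dom b (F (chart_inv a x)), chart_map a (chart_inv a x) = x,
    F (chart_inv a x) = chart_inv b (coord_rep F a b x) &
    (chart_map b @` chart_dom b) (coord_rep F a b x)].
Proof.
move=> [p [ap bp] <-]; rewrite /coord_rep /= (mfd_mapK (manifoldP M) ap).
by rewrite (mfd_mapK (manifoldP N) bp); split=> //; exists (F p).
Qed.

Lemma coord_rep_smooth V W (M : manifold V) (N : manifold W) (F : M -> N)
    n a b :
  smooth_map F -> class_C n (coord_dom F a b) (coord_rep F a b).
Proof. by move=> [_ /(_ a b n)]. Qed.

Lemma coord_rep_differentiable V W (M : manifold V) (N : manifold W)
    (F : M -> N) a b x :
  smooth_map F -> coord_dom F a b x -> differentiable (coord_rep F a b) x.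
Proof. by move=> sF; have [+ _] := coord_rep_smooth 1 a b sF; exact. Qed.

Lemma tangent_mapE V W (M : manifold V) (N : manifold W) (F : M -> N) a b x v :
  smooth_map F -> coord_dom F a b x ->
  tangent_map F a b (chart_inv a x) v = 'D_v (coord_rep F a b) x.
Proof.
move=> sF dx; have [_ _ xE _ _] := coord_domP dx.
by rewrite /tangent_map xE -deriveE //; exact: coord_rep_differentiable.
Qed.

Lemma smooth_map_id V (M : manifold V) : smooth_map (@idfun M).
Proof.
by split=> [p|a b]; [exact: cvg_id|exact: (mfd_transition (manifoldP M))].
Qed.

Lemma tangent_comp V1 V2 V3 (M1 : manifold V1) (M2 : manifold V2)
    (M3 : manifold V3) (F : M1 -> M2) (G : M2 -> M3) a b c p v :
  smooth_map F -> smooth_map G ->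
  chart_dom a p -> chart_dom b (F p) -> chart_dom c (G (F p)) ->
  tangent_map (G \o F) a c p v =
  tangent_map G b c (F p) (tangent_map F a b p v).
Proof.
move=> sF sG ap bFp cGp.
have ax : coord_dom F a b (chart_map a p) by exists p.
have bx : coord_dom G b c (coord_rep F a b (chart_map a p)).
  by exists (F p) => //; rewrite /coord_rep /= (mfd_mapK (manifoldP M1) ap).
have dF := coord_rep_differentiable sF ax.
have dG := coord_rep_differentiable sG bx.
(* The middle chart cancels only where [F] lands in its domain, so the chain rule goes through an
   equality near the point. *)
have near_eq : \forall y \near chart_map a p,
    (coord_rep G b c \o coord_rep F a b) y = coord_rep (G \o F) a c y.
  apply: (open_nearT (coord_dom_open a b sF.1) ax) => y /coord_domP [_ _ _ E _].
  by rewrite {1}/coord_rep /= -E.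
have [_] := near_eq_diff near_eq (differentiable_comp dF dG).
have E : chart_map b (F p) = coord_rep F a b (chart_map a p).
  by rewrite /coord_rep /= (mfd_mapK (manifoldP M1) ap).
by rewrite /tangent_map E => ->; rewrite (diff_comp dF dG).
Qed.

(** The chain rule with the identity of [M], whose tangent map is the Jacobian of the change of
    charts; the next lemma is the counterpart on the target. *)
Lemma tangent_map_change_source V W (M : manifold V) (N : manifold W)
    (F : M -> N) a b c p v : smooth_map F ->
  chart_dom a p -> chart_dom b p -> chart_dom c (F p) ->
  tangent_map F a c p v = tangent_map F b c p (tangent_map (@idfun M) a b p v).
Proof.
move=> sF ap bp cp; have sid := smooth_map_id M.
by rewrite -(tangent_comp (F := @idfun M) (G := F)).
Qed.

Lemma tangent_map_change_target V W (M : manifold V) (N : manifold W)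
    (F : M -> N) a b c p v : smooth_map F ->
  chart_dom a p -> chart_dom b (F p) -> chart_dom c (F p) ->
  tangent_map F a c p v =
  tangent_map (@idfun N) b c (F p) (tangent_map F a b p v).
Proof.
move=> sF ap bp cp; have sid := smooth_map_id N.
by rewrite -(tangent_comp (F := F) (G := @idfun N)).
Qed.

Lemma tangent_map_linear V W (M : charted_space V) (N : charted_space W)
    (F : M -> N) a b p : linear (tangent_map F a b p).
Proof. by move=> c u v; rewrite /tangent_map linearP. Qed.

Lemma tangent_map0 V W (M : charted_space V) (N : charted_space W)
    (F : M -> N) a b p : tangent_map F a b p 0 = 0.
Proof. by rewrite /tangent_map linear0. Qed.

End Charts.

(** * Consequences of linearity held as a proposition *)

Section Linear.
Context {R : realType} {V W : lmodType R}.

Lemma linear_fun0 (f : V -> W) : linear f -> f 0 = 0.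
Proof.
by move=> fl; have := fl (-1) 0 0; rewrite scaler0 addr0 scaleN1r addNr.
Qed.

Lemma linear_funN (f : V -> W) u : linear f -> f (- u) = - f u.
Proof.
move=> fl; have := fl (-1) u 0; rewrite !scaleN1r !addr0 => ->.
by rewrite linear_fun0 // addr0.
Qed.

Lemma linear_funD (f : V -> W) u v : linear f -> f (u + v) = f u + f v.
Proof. by move=> fl; have := fl 1 u v; rewrite !scale1r. Qed.

Lemma linear_funZ (f : V -> W) c u : linear f -> f (c *: u) = c *: f u.
Proof.
move=> fl; have := fl c u 0; rewrite !addr0 => ->.
by rewrite linear_fun0 // addr0.
Qed.

End Linear.

(** * Smoothness of tensor fields along a map, on variable arguments *)

Section SmoothAlong.
Context {R : realType} {p q : nat} {V : normedModType R}.
Context (M : manifold 'M[R]_(p, q)).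
Variables (n : nat) (b : chart M) (U : set V) (F : V -> 'M[R]_(p, q)).
Hypotheses (oU : open U) (CF : class_C n U F).
Hypothesis (FU : forall x, U x -> (chart_map b @` chart_dom b) (F x)).

Lemma chart_inv_dom x : U x -> chart_dom b (chart_inv b (F x)).
Proof. by move=> /FU [r br <-]; rewrite (mfd_mapK (manifoldP M) br). Qed.

Let oimg : open (chart_map b @` chart_dom b).
Proof. exact: mfd_image_open (manifoldP M) b. Qed.

Lemma vfield_smooth_along (X : vfield M) : is_vfield X ->
  class_C n U (fun x => X b (chart_inv b (F x))).
Proof.
move=> fX; apply: class_C_mx => // i j.
apply: (class_C_comp oU oimg FU CF (g := fun y => X b (chart_inv b y) i j)).
exact: (class_C_entry i j oimg (vfield_smooth fX b n)).
Qed.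

Lemma covector_smooth_along (w : covector_field M) S : is_covector_field w ->
  class_C n U S -> class_C n U (fun x => w b (chart_inv b (F x)) (S x)).
Proof.
move=> fw CS.
apply: (class_C_linear_arg (Q := fun x => w b (chart_inv b (F x))) oU _ _ CS)
  => [x Ux|z].
  exact: (covector_linear fw (chart_inv_dom Ux)).
apply: (class_C_comp oU oimg FU CF (g := fun y => w b (chart_inv b y) z)).
exact: (covector_smooth fw b z n).
Qed.

Lemma endo_smooth_along (T : endo_field M) S : is_endo_field T ->
  class_C n U S -> class_C n U (fun x => T b (chart_inv b (F x)) (S x)).
Proof.
move=> fT CS; apply: class_C_mx => // i j.
apply: (class_C_linear_arg (Q := fun x z => T b (chart_inv b (F x)) z i j)
  oU _ _ CS) => [x Ux c u v|z].
  by rewrite (endo_linear fT (chart_inv_dom Ux)) !mxE.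
apply: (class_C_comp oU oimg FU CF (g := fun y => T b (chart_inv b y) z i j)).
exact: (class_C_entry i j oimg (endo_smooth fT b z n)).
Qed.

Lemma metric_smooth_along (g : bilinear_field M) S T : is_metric g ->
  class_C n U S -> class_C n U T ->
  class_C n U (fun x => g b (chart_inv b (F x)) (S x) (T x)).
Proof.
move=> fg CS CT.
apply: (class_C_linear_arg (Q := fun x => g b (chart_inv b (F x)) (S x))
  oU _ _ CT) => [x Ux|z].
  exact: (metric_linear fg _ (chart_inv_dom Ux)).
apply: (class_C_linear_arg (Q := fun x => g b (chart_inv b (F x)) ^~ z)
  oU _ _ CS) => [x Ux c u v|y].
  have bx := chart_inv_dom Ux.
  by rewrite !(Defs.metric_sym fg _ z bx) (metric_linear fg z bx).
apply: (class_C_comp oU oimg FU CF (g := fun r => g b (chart_inv b r) y z)).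
exact: (metric_smooth fg b y z n).
Qed.

End SmoothAlong.

(** * Recovering a vector field from its inner products *)

Lemma class_C_det (R : realType) (V : normedModType R) n m (U : set V)
    (A : V -> 'M[R]_n) : open U ->
  class_C m U A -> class_C m U (fun x => \det (A x)).
Proof.
move=> oU CA; apply: class_C_bigsum => // s _; apply: class_CM => //.
  exact: class_C_cst.
by apply: class_C_prod => // i _; exact: class_C_entry.
Qed.

Lemma class_C_adj (R : realType) (V : normedModType R) n m (U : set V)
    (A : V -> 'M[R]_n) : open U ->
  class_C m U A -> class_C m U (fun x => \adj (A x)).
Proof.
move=> oU CA; apply: class_C_mx => // i j.
apply: (eq_class_C oU (f := fun x => (-1) ^+ (j + i) *
    \det (row' j (col' i (A x))))) => [x Ux|]; first by rewrite mxE.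
apply: class_CM => //; first exact: class_C_cst.
apply: (class_C_det (A := fun x => row' j (col' i (A x)))) => //.
apply: class_C_mx => // k l.
apply: (eq_class_C oU (f := fun x => A x (lift j k) (lift i l))) => [x Ux|].
  by rewrite !mxE.
exact: class_C_entry.
Qed.

Section MetricSolve.
Context {R : realType} {n : nat} (N : manifold 'rV[R]_n).
Variables (g : bilinear_field N) (fg : is_metric g).

(* The coordinates of [Y] are recovered from the inner products by inverting the
   Gram matrix of the standard basis. *)
Lemma smooth_of_inner m (a : chart N) (U : set 'rV[R]_n)
    (Y : 'rV[R]_n -> 'rV[R]_n) : open U -> U `<=` chart_map a @` chart_dom a ->
  (forall u, class_C m U (fun x => g a (chart_inv a x) u (Y x))) ->
  class_C m U Y.
Proof.
move=> oU Uimg CY; pose e (i : 'I_n) : 'rV[R]_n := delta_mx ord0 i.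
pose G x : 'M[R]_n := \matrix_(i, j) g a (chart_inv a x) (e i) (e j).
pose h x : 'rV[R]_n := \row_j g a (chart_inv a x) (e j) (Y x).
have ax x : U x -> chart_dom a (chart_inv a x).
  by move=> /Uimg [r ar <-]; rewrite (mfd_mapK (manifoldP N) ar).
have gE x u v : U x -> g a (chart_inv a x) u v = (u *m G x *m v^T) ord0 ord0.
  move=> Ux.
  rewrite (@linear_mx_sum _ _ _ R^o _ v (metric_linear fg u (ax x Ux))).
  rewrite big_ord1 mxE; apply: eq_bigr => j _; rewrite !mxE mulrC.
  congr (_ * _); rewrite (Defs.metric_sym fg _ _ (ax x Ux)).
  rewrite (@linear_mx_sum _ _ _ R^o _ u (metric_linear fg _ (ax x Ux))).
  rewrite big_ord1; apply: eq_bigr => i _; rewrite !mxE; congr (_ * _).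
  by rewrite (Defs.metric_sym fg _ _ (ax x Ux)).
have Gunit x : U x -> G x \in unitmx.
  (* A row [u] with [u *m G x = 0] has [g u u = 0], which positivity forbids unless [u] is 0. *)
  move=> Ux; rewrite -row_free_unit -kermx_eq0; apply/eqP/row_matrixP => i.
  rewrite row0; set u := row i _.
  apply/eqP/negPn/negP => u0; have := metric_pos fg (ax x Ux) u0.
  by rewrite gE // (sub_kermxP (row_sub i _)) mul0mx mxE ltxx.
have YE x : U x -> Y x = h x *m invmx (G x).
  move=> Ux; apply: (canRL (mulmxK (Gunit x Ux))); apply/rowP => j.
  rewrite [RHS]mxE (Defs.metric_sym fg _ _ (ax x Ux)) gE //.
  by rewrite /e trmx_delta -colE [RHS]mxE.
have CG : class_C m U G.
  apply: class_C_mx => // i j.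
  apply: (eq_class_C oU (f := fun x => g a (chart_inv a x) (e i) (e j))).
    by move=> x Ux; rewrite mxE.
  by apply: sub_class_C Uimg _; exact: (metric_smooth fg a (e i) (e j) m).
have Ch j : class_C m U (fun x => h x ord0 j).
  apply: (eq_class_C oU (f := fun x => g a (chart_inv a x) (e j) (Y x))) => //.
  by move=> x Ux; rewrite mxE.
apply: class_C_mx => // i j; rewrite (ord1 i).
(* The adjugate formula for the inverse: polynomials in the entries of [G x], divided by a
   determinant that does not vanish on [U]. *)
apply: (eq_class_C oU (f := fun x =>
    \sum_l h x ord0 l * ((\det (G x))^-1 * \adj (G x) l j))) => [x Ux|].
  rewrite (YE x Ux) mxE; apply: eq_bigr => l _.
  by rewrite /invmx (Gunit x Ux) (ord1 0); congr (_ * _); rewrite [RHS]mxE.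
apply: class_C_bigsum => // l _; apply: class_CM => //; apply: class_CM => //.
  apply: class_CV => // [x Ux|]; last exact: class_C_det.
  by rewrite -unitfE -unitmxE; exact: Gunit.
exact: (class_C_entry l j oU (class_C_adj oU CG)).
Qed.

End MetricSolve.

(** * Pullbacks and restrictions to an immersed submanifold *)

Section Immersion.
Context {R : realType} {n p q : nat}.
Context (M : manifold 'M[R]_(p, q)) (N : manifold 'rV[R]_n) (iota : N -> M).
Hypothesis smooth_iota : smooth_map iota.

Lemma coord_dom_sub (a : chart N) (b : chart M) :
  coord_dom iota a b `<=` chart_map a @` chart_dom a.
Proof. by move=> _ [r [ar _] <-]; exists r. Qed.

(** The formulas for induced tensors involve a chart [b] of [M] and hold only where [iota] lands in
    its domain; such open sets cover the chart [a]. *)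
Lemma class_C_chart_cover (W : normedModType R) m (a : chart N)
    (f : 'rV[R]_n -> W) :
  (forall b : chart M, class_C m (coord_dom iota a b) f) ->
  class_C m (chart_map a @` chart_dom a) f.
Proof.
move=> Cf; apply: class_C_local => _ [r ar <-].
have [b br] := mfd_cover (manifoldP M) (iota r).
exists (coord_dom iota a b); split=> //; last by exists r.
exact: coord_dom_open smooth_iota.1.
Qed.

Let image_dom (a : chart N) (b : chart M) x : coord_dom iota a b x ->
  (chart_map b @` chart_dom b) (coord_rep iota a b x).
Proof. by move=> /coord_domP []. Qed.

Let oD (a : chart N) (b : chart M) : open (coord_dom iota a b).
Proof. exact: coord_dom_open smooth_iota.1. Qed.

Let CF m (a : chart N) (b : chart M) :
  class_C m (coord_dom iota a b) (coord_rep iota a b).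
Proof. exact: coord_rep_smooth. Qed.

Let CDF m (a : chart N) (b : chart M) v :
  class_C m (coord_dom iota a b) ('D_v (coord_rep iota a b)).
Proof. by have [_ /(_ v)] := CF m.+1 a b. Qed.

Lemma pullback_is_covector_field (w' : covector_field N)
    (w : covector_field M) :
  is_covector_field w -> pullback_covector iota w' w -> is_covector_field w'.
Proof.
move=> fw w'E; split.
- move=> a r ar c u v.
  have [b br] := mfd_cover (manifoldP M) (iota r).
  by rewrite !(w'E a b) // tangent_map_linear (covector_linear fw br).
- move=> a a' r v ar a'r; have [b br] := mfd_cover (manifoldP M) (iota r).
  rewrite (w'E a b) // (w'E a' b) //.
  by rewrite (tangent_map_change_source v smooth_iota ar a'r br).
move=> a v m; apply: class_C_chart_cover => b.
apply: (eq_class_C (@oD a b) (f := fun x =>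
  w b (chart_inv b (coord_rep iota a b x)) ('D_v (coord_rep iota a b) x))).
  move=> x dx; have [ax bx _ E _] := coord_domP dx.
  by rewrite (w'E a b) // (tangent_mapE v smooth_iota dx) -E.
exact: (covector_smooth_along (@oD a b) (CF m a b) (@image_dom a b) fw
  (CDF m a b v)).
Qed.

Hypothesis immersion : forall (a : chart N) (b : chart M) r,
  chart_dom a r -> chart_dom b (iota r) -> injective (tangent_map iota a b r).

(** Injectivity of the differential is what keeps the pulled back form positive. *)
Lemma pullback_is_metric (g' : bilinear_field N) (g : bilinear_field M) :
  is_metric g -> pullback_bilinear iota g' g -> is_metric g'.
Proof.
move=> fg g'E; split.
- move=> a r u ar c v v'; have [b br] := mfd_cover (manifoldP M) (iota r).
  by rewrite !(g'E a b) // tangent_map_linear (metric_linear fg _ br).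
- move=> a r u v ar; have [b br] := mfd_cover (manifoldP M) (iota r).
  by rewrite !(g'E a b) // (Defs.metric_sym fg _ _ br).
- move=> a r v ar v0; have [b br] := mfd_cover (manifoldP M) (iota r).
  rewrite (g'E a b) //; apply: (metric_pos fg br).
  apply/eqP => Tv; move/eqP: v0; apply.
  by apply: (immersion ar br); rewrite Tv tangent_map0.
- move=> a a' r u v ar a'r; have [b br] := mfd_cover (manifoldP M) (iota r).
  rewrite (g'E a b) // (g'E a' b) //.
  by rewrite !(tangent_map_change_source _ smooth_iota ar a'r br).
move=> a u v m; apply: class_C_chart_cover => b.
apply: (eq_class_C (@oD a b) (f := fun x =>
  g b (chart_inv b (coord_rep iota a b x)) ('D_u (coord_rep iota a b) x)
    ('D_v (coord_rep iota a b) x))).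
  move=> x dx; have [ax bx _ E _] := coord_domP dx.
  by rewrite (g'E a b) // !(tangent_mapE _ smooth_iota dx) -E.
exact: (metric_smooth_along (@oD a b) (CF m a b) (@image_dom a b) fg
  (CDF m a b u) (CDF m a b v)).
Qed.

(** The change of charts is checked after applying the injective differential. For smoothness,
    [g' u X'] equals [g] on the pushed forward [u] and on [X], and [smooth_of_inner] concludes. *)
Lemma restriction_is_vfield (g' : bilinear_field N) (g : bilinear_field M)
    (X' : vfield N) (X : vfield M) :
  is_metric g -> pullback_bilinear iota g' g ->
  is_vfield X -> restricts_vfield iota X' X -> is_vfield X'.
Proof.
move=> fg g'E fX X'E; have fg' := pullback_is_metric fg g'E; split.
  move=> a a' r ar a'r; have [b br] := mfd_cover (manifoldP M) (iota r).
  apply: (immersion a'r br); rewrite X'E //.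
  by rewrite -(tangent_map_change_source _ smooth_iota ar a'r br) X'E.
move=> a m; apply: class_C_chart_cover => b.
apply: (smooth_of_inner fg' (@oD a b) (@coord_dom_sub a b)) => u.
apply: (eq_class_C (@oD a b) (f := fun x =>
  g b (chart_inv b (coord_rep iota a b x)) ('D_u (coord_rep iota a b) x)
    (X b (chart_inv b (coord_rep iota a b x))))).
  move=> x dx; have [ax bx _ E _] := coord_domP dx.
  by rewrite (g'E a b) // X'E // (tangent_mapE _ smooth_iota dx) -E.
exact: (metric_smooth_along (@oD a b) (CF m a b) (@image_dom a b) fg
  (CDF m a b u) (vfield_smooth_along (@oD a b) (CF m a b) (@image_dom a b) fX)).
Qed.

Lemma restriction_is_endo_field (g' : bilinear_field N) (g : bilinear_field M)
    (T' : endo_field N) (T : endo_field M) :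
  is_metric g -> pullback_bilinear iota g' g ->
  is_endo_field T -> restricts_endo iota T' T -> is_endo_field T'.
Proof.
move=> fg g'E fT T'E; have fg' := pullback_is_metric fg g'E; split.
- move=> a r ar c u v; have [b br] := mfd_cover (manifoldP M) (iota r).
  apply: (immersion ar br); rewrite tangent_map_linear !T'E //.
  by rewrite tangent_map_linear (endo_linear fT br).
- move=> a a' r v ar a'r; have [b br] := mfd_cover (manifoldP M) (iota r).
  apply: (immersion a'r br).
  rewrite -(tangent_map_change_source _ smooth_iota ar a'r br) !T'E //.
  by rewrite -(tangent_map_change_source _ smooth_iota ar a'r br).
move=> a v m; apply: class_C_chart_cover => b.
apply: (smooth_of_inner fg' (@oD a b) (@coord_dom_sub a b)) => u.
apply: (eq_class_C (@oD a b) (f := fun x =>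
  g b (chart_inv b (coord_rep iota a b x)) ('D_u (coord_rep iota a b) x)
    (T b (chart_inv b (coord_rep iota a b x)) ('D_v (coord_rep iota a b) x)))).
  move=> x dx; have [ax bx _ E _] := coord_domP dx.
  by rewrite (g'E a b) // T'E // !(tangent_mapE _ smooth_iota dx) -E.
exact: (metric_smooth_along (@oD a b) (CF m a b) (@image_dom a b) fg
  (CDF m a b u)
  (endo_smooth_along (@oD a b) (CF m a b) (@image_dom a b) fT (CDF m a b v))).
Qed.

(** A chart of [M] is chosen at each point of the image; the transformation law makes the value
    independent of that choice. *)
Lemma exists_pullback_covector (w : covector_field M) : is_covector_field w ->
  exists w', pullback_covector iota w' w.
Proof.
move=> fw; pose b r := sval (cid (mfd_cover (manifoldP M) (iota r))).
have bP r : chart_dom (b r) (iota r) by rewrite /b; case: cid.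
exists (fun a r v => w (b r) (iota r) (tangent_map iota a (b r) r v)).
move=> a b' r v ar b'r; rewrite (covector_change fw _ (bP r) b'r).
by rewrite -(tangent_map_change_target v smooth_iota ar (bP r) b'r).
Qed.

Lemma exists_pullback_bilinear (g : bilinear_field M) : is_metric g ->
  exists g', pullback_bilinear iota g' g.
Proof.
move=> fg; pose b r := sval (cid (mfd_cover (manifoldP M) (iota r))).
have bP r : chart_dom (b r) (iota r) by rewrite /b; case: cid.
exists (fun a r u v => g (b r) (iota r) (tangent_map iota a (b r) r u)
  (tangent_map iota a (b r) r v)).
move=> a b' r u v ar b'r; rewrite (metric_change fg _ _ (bP r) b'r).
by rewrite -!(tangent_map_change_target _ smooth_iota ar (bP r) b'r).
Qed.

Lemma exists_restriction_vfield (X : vfield M) : is_vfield X ->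
  (forall (a : chart N) (b : chart M) r, chart_dom a r ->
    chart_dom b (iota r) -> range (tangent_map iota a b r) (X b (iota r))) ->
  exists X', restricts_vfield iota X' X.
Proof.
move=> fX tX; pose b r := sval (cid (mfd_cover (manifoldP M) (iota r))).
have bP r : chart_dom (b r) (iota r) by rewrite /b; case: cid.
(* The default 0 is never returned, since [tX] provides a preimage. *)
exists (fun a r => xget 0 [set u |
  tangent_map iota a (b r) r u = X (b r) (iota r)]).
move=> a b' r ar b'r; case: xgetP => [_ -> E|].
  rewrite (tangent_map_change_target _ smooth_iota ar (bP r) b'r) E.
  by rewrite -(vfield_change fX (bP r) b'r).
by have [u _ Xu] := tX a (b r) r ar (bP r) => /(_ u) []; exact: Xu.
Qed.

Lemma exists_restriction_endo (T : endo_field M) : is_endo_field T ->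
  (forall (a : chart N) (b : chart M) r v, chart_dom a r ->
    chart_dom b (iota r) ->
    range (tangent_map iota a b r) (T b (iota r) (tangent_map iota a b r v))) ->
  exists T', restricts_endo iota T' T.
Proof.
move=> fT tT; pose b r := sval (cid (mfd_cover (manifoldP M) (iota r))).
have bP r : chart_dom (b r) (iota r) by rewrite /b; case: cid.
exists (fun a r v => xget 0 [set u | tangent_map iota a (b r) r u =
  T (b r) (iota r) (tangent_map iota a (b r) r v)]).
move=> a b' r v ar b'r; case: xgetP => [_ -> E|].
  rewrite !(tangent_map_change_target _ smooth_iota ar (bP r) b'r) E.
  by rewrite (endo_change fT _ (bP r) b'r).
by have [u _ Tu] := tT a (b r) r v ar (bP r) => /(_ u) []; exact: Tu.
Qed.

End Immersion.

(** * Tensor fields on a product *)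

Lemma row_sum_block (R : realType) k n (x : 'I_k -> 'rV[R]_n) j :
  row j (\sum_i block i (x i)) = x j.
Proof.
rewrite linear_sum (bigD1 j) //= row_block eqxx big1 ?addr0 // => i ij.
by rewrite row_block eq_sym (negPf ij).
Qed.

Section ProductTensors.
Context {R : realType} {k n : nat} (C : 'I_k -> manifold 'rV[R]_n).
Let M := product_manifold C.
Implicit Types (a b : chart M) (p : M).

(** In coordinates the projection is [row i] followed by a change of charts of [C i]. *)
Lemma projection_smooth i : smooth_map (@projection R k n C i).
Proof.
split=> [p|a b m]; first exact: (@proj_continuous _ (fun i => points (C i)) i).
have -> : chart_map b \o @projection R k n C i \o chart_inv a =
    coord_rep (@idfun (C i)) (a i) b \o row i by [].
have := class_C_precomp (@row_continuous R k n i)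
  (coord_rep_smooth m (a i) b (smooth_map_id (C i))).
apply: sub_class_C => _ [p [ap bp] <-]; exists (p i).
  by split; [exact: ap|exact: bp].
exact: esym (row_chart_map a p i).
Qed.

(** Rows are differentials of projections, so both sides compute the tangent map of [projection i]
    from [a] to [b i]: one changes the chart at the source, the other at the target. *)
Lemma row_tangent_idfun a b p (u : 'M[R]_(k, n)) i :
  chart_dom a p -> chart_dom b p ->
  row i (tangent_map (@idfun M) a b p u) =
  tangent_map (@idfun (C i)) (a i) (b i) (p i) (row i u).
Proof.
move=> ap bp; have sp := projection_smooth i.
have -> : row i u = d_projection i a p u by rewrite d_projectionE.
rewrite -[LHS](congr1 (@^~ _) (d_projectionE i bp)) /d_projection.
rewrite -(tangent_map_change_source u sp ap bp (bp i)).
exact: (tangent_map_change_target u sp ap (ap i) (bp i)).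
Qed.

Lemma img_row a x i : (chart_map a @` chart_dom a) x ->
  (chart_map (a i) @` chart_dom (a i)) (row i x).
Proof.
by move=> [p ap <-]; exists (p i); rewrite ?row_chart_map //; exact: ap.
Qed.

Lemma chart_dom_inv a x : (chart_map a @` chart_dom a) x ->
  chart_dom a (chart_inv a x).
Proof. by move=> [p ap <-]; rewrite (mfd_mapK (manifoldP M) ap). Qed.

Let oimg a : open (chart_map a @` chart_dom a).
Proof. exact: (mfd_image_open (manifoldP M) a). Qed.

Lemma class_C_row (W : normedModType R) m a i (f : 'rV[R]_n -> W) :
  class_C m (chart_map (a i) @` chart_dom (a i)) f ->
  class_C m (chart_map a @` chart_dom a) (fun x => f (row i x)).
Proof.
move=> Cf; have := class_C_precomp (@row_continuous R k n i) Cf.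
by apply: sub_class_C => x; exact: img_row.
Qed.

Lemma class_C_block m a (f : forall i, 'rV[R]_n -> 'rV[R]_n) :
  (forall i, class_C m (chart_map (a i) @` chart_dom (a i)) (f i)) ->
  class_C m (chart_map a @` chart_dom a)
    (fun x => \sum_i block i (f i (row i x))).
Proof.
move=> Cf; apply: class_C_bigsum => // i _.
exact: (class_C_postcomp (@oimg a) (@block_continuous R k n i)
  (class_C_row (Cf i))).
Qed.

(** Stated for arbitrary factors; [canonical_f] is an instance by conversion, as are [median_vfield]
    and [canonical_g] of the analogous definitions below. *)
Definition sum_lift_endo (T : forall i, endo_field (C i)) : endo_field M :=
  fun a p u => \sum_i lift_endo (T i) a p u.

Lemma row_sum_lift_endo T a p u j : chart_dom a p ->
  row j (sum_lift_endo T a p u) = T j (a j) (p j) (row j u).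
Proof.
by move=> ap; rewrite /sum_lift_endo /lift_endo row_sum_block d_projectionE.
Qed.

Lemma sum_lift_endo_is_endo_field T : (forall i, is_endo_field (T i)) ->
  is_endo_field (sum_lift_endo T).
Proof.
move=> fT; split.
- move=> a p ap c u v; apply/row_matrixP => j.
  rewrite [RHS]linearP /= !row_sum_lift_endo // linearP /=.
  exact: (endo_linear (fT j) (ap j)).
- move=> a b p v ap bp; apply/row_matrixP => j.
  rewrite row_tangent_idfun // !row_sum_lift_endo // row_tangent_idfun //.
  exact: (endo_change (fT j) _ (ap j) (bp j)).
move=> a v m; apply: (eq_class_C (@oimg a) (f := fun x => \sum_i block i
    (T i (a i) (chart_inv (a i) (row i x)) (row i v))))
    => [x /chart_dom_inv ax|].
  by apply/row_matrixP => j; rewrite row_sum_block row_sum_lift_endo.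
apply: (class_C_block (f := fun i y =>
  T i (a i) (chart_inv (a i) y) (row i v))) => i.
exact: (endo_smooth (fT i)).
Qed.

Definition scaled_sum_lift_vfield c (X : forall i, vfield (C i)) : vfield M :=
  fun a p => c *: \sum_i lift_vfield (X i) a p.

Lemma row_scaled_sum_lift_vfield c X a p j :
  row j (scaled_sum_lift_vfield c X a p) = c *: X j (a j) (p j).
Proof. by rewrite linearZ /= row_sum_block. Qed.

Lemma scaled_sum_lift_is_vfield c X : (forall i, is_vfield (X i)) ->
  is_vfield (scaled_sum_lift_vfield c X).
Proof.
move=> fX; split.
  move=> a b p ap bp; apply/row_matrixP => j.
  rewrite row_tangent_idfun // !row_scaled_sum_lift_vfield.
  rewrite (vfield_change (fX j) (ap j) (bp j)) linear_funZ //.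
  exact: tangent_map_linear.
move=> a m; apply: (eq_class_C (@oimg a) (f := fun x => \sum_i block i
    (c *: X i (a i) (chart_inv (a i) (row i x))))) => [x _|].
  by apply/row_matrixP => j; rewrite row_sum_block row_scaled_sum_lift_vfield.
apply: (class_C_block (f := fun i y => c *: X i (a i) (chart_inv (a i) y)))
  => i.
have oi := mfd_image_open (manifoldP (C i)) (a i).
apply: class_C_mx => // r s; apply: (eq_class_C oi (f := fun y =>
    c * X i (a i) (chart_inv (a i) y) r s)) => [y _|]; first by rewrite mxE.
apply: class_CM => //; first exact: class_C_cst.
exact: (class_C_entry r s oi (vfield_smooth (fX i) (a i) m)).
Qed.

Lemma scaled_proj_pullback_is_covector_field c i (w : covector_field (C i)) :
  is_covector_field w ->
  is_covector_field (fun a p u => c * proj_pullback_covector w a p u : R).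
Proof.
move=> fw; split.
- move=> a p ap d u v; rewrite /proj_pullback_covector d_projectionE //.
  by rewrite linearP /= (covector_linear fw (ap i)) mulrDr mulrCA.
- move=> a b p v ap bp; rewrite /proj_pullback_covector !d_projectionE //.
  rewrite row_tangent_idfun //; congr (_ * _).
  exact: (covector_change fw _ (ap i) (bp i)).
move=> a v m; apply: (eq_class_C (@oimg a) (f := fun x =>
    c * w (a i) (chart_inv (a i) (row i x)) (row i v)))
    => [x /chart_dom_inv ax|].
  by rewrite /proj_pullback_covector d_projectionE.
apply: class_CM; [exact: oimg|exact: class_C_cst|].
apply: (class_C_row (f := fun y => w (a i) (chart_inv (a i) y) (row i v))).
exact: (covector_smooth fw).
Qed.

Definition sum_proj_pullback_bilinear (g : forall i, bilinear_field (C i)) :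
    bilinear_field M :=
  fun a p u v => \sum_i proj_pullback_bilinear (g i) a p u v.

Lemma sum_proj_pullback_bilinearE g a p u v : chart_dom a p ->
  sum_proj_pullback_bilinear g a p u v =
  \sum_i g i (a i) (p i) (row i u) (row i v).
Proof.
move=> ap; apply: eq_bigr => i _.
by rewrite /proj_pullback_bilinear d_projectionE.
Qed.

Lemma sum_proj_pullback_is_metric g : (forall i, is_metric (g i)) ->
  is_metric (sum_proj_pullback_bilinear g).
Proof.
move=> fg; split.
- move=> a p u ap c v v'; rewrite !sum_proj_pullback_bilinearE //.
  rewrite mulr_sumr -big_split; apply: eq_bigr => i _; rewrite linearP /=.
  exact: (metric_linear (fg i) _ (ap i)).
- move=> a p u v ap; rewrite !sum_proj_pullback_bilinearE //.
  by apply: eq_bigr => i _; exact: (Defs.metric_sym (fg i) _ _ (ap i)).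
- move=> a p v ap v0; rewrite sum_proj_pullback_bilinearE //.
  have pos i : row i v != 0 -> 0 < g i (a i) (p i) (row i v) (row i v).
    exact: (metric_pos (fg i) (ap i)).
  have nneg i : 0 <= g i (a i) (p i) (row i v) (row i v).
    have [->|/pos/ltW//] := eqVneq (row i v) 0.
    by rewrite (linear_fun0 (W := R^o) (metric_linear (fg i) _ (ap i))).
  have [i vi] : exists i, row i v != 0.
    apply/existsP; apply: contraNT v0 => /existsPn v0.
    apply/eqP/row_matrixP => i; rewrite row0; apply/eqP.
    by have := v0 i; rewrite negbK.
  rewrite (bigD1 i) //= ltr_wpDr ?pos //.
  by apply: sumr_ge0 => j _.
- move=> a b p u v ap bp; rewrite !sum_proj_pullback_bilinearE //.
  apply: eq_bigr => i _; rewrite !row_tangent_idfun //.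
  exact: (metric_change (fg i) _ _ (ap i) (bp i)).
move=> a u v m; apply: (eq_class_C (@oimg a) (f := fun x => \sum_i
    (g i (a i) (chart_inv (a i) (row i x)) (row i u) (row i v))))
    => [x /chart_dom_inv ax|].
  by rewrite sum_proj_pullback_bilinearE.
apply: class_C_bigsum => [|i _]; first exact: oimg.
apply: (class_C_row (f := fun y =>
  g i (a i) (chart_inv (a i) y) (row i u) (row i v))).
exact: (metric_smooth (fg i)).
Qed.

End ProductTensors.

(** * Sewed cells *)

Section AlmostContact.
Context {R : realType} {V : normedModType R} (M : manifold V).
Context (phi : endo_field M) (xi : vfield M) (eta : covector_field M).
Context (g : bilinear_field M) (acm : almost_contact_metric phi xi eta g).
Variables (a : chart M) (p : M) (ap : chart_dom a p).

Let phil := endo_linear (acm_phi acm) ap.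
Let etal := covector_linear (acm_eta acm) ap.
Let gl u := metric_linear (acm_g acm) u ap.
Let gsym u v := Defs.metric_sym (acm_g acm) u v ap.
Let phi2 v := acm_phi2 acm v ap.
Let eta_xi := acm_eta_xi acm ap.

(* From the two ways of evaluating [phi^3 v]. *)
Lemma acm_phi_cube v :
  eta a p (phi a p v) *: xi a p = eta a p v *: phi a p (xi a p).
Proof.
have := phi2 (phi a p v).
rewrite (phi2 v) linear_funD // linear_funN // linear_funZ //.
by move=> /addrI.
Qed.

(** By [acm_phi_cube] at [xi], the vector [phi xi] is a multiple [c *: xi]; since
    [phi (phi xi) = 0], the square of [c] vanishes. *)
Lemma acm_phi_xi : phi a p (xi a p) = 0.
Proof.
have [c E] : exists c, phi a p (xi a p) = c *: xi a p.
  have := acm_phi_cube (xi a p); rewrite eta_xi scale1r => <-.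
  by exists (eta a p (phi a p (xi a p))).
have := phi2 (xi a p); rewrite eta_xi scale1r addNr E linear_funZ // E scalerA.
move=> /(congr1 (eta a p)); rewrite (linear_funZ (W := R^o) _ _ etal) eta_xi.
rewrite (linear_fun0 (W := R^o) etal) -[_ *: _]/(_ * _) mulr1 => /eqP.
by rewrite mulf_eq0 orbb => /eqP ->; rewrite scale0r.
Qed.

Lemma acm_eta_phi v : eta a p (phi a p v) = 0.
Proof.
have := acm_phi_cube v; rewrite acm_phi_xi scaler0 => /(congr1 (eta a p)).
rewrite (linear_funZ (W := R^o) _ _ etal) (linear_fun0 (W := R^o) etal) eta_xi.
by rewrite -[_ *: _]/(_ * _) mulr1.
Qed.

(** Compatibility at [u] and [phi v] gives g(u, phi v) = g(phi u, phi (phi v)), as [eta] kills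
    [phi v]. Expanding the square leaves - g(phi u, v), because [phi u] is orthogonal to [xi]. *)
Lemma acm_skew u v : g a p u (phi a p v) = - g a p v (phi a p u).
Proof.
have g_phi_xi w : g a p (phi a p w) (xi a p) = 0.
  have := acm_compatible acm (phi a p w) (xi a p) ap.
  rewrite acm_phi_xi (linear_fun0 (W := R^o) (gl _)) acm_eta_phi mul0r subr0.
  by move=> <-.
have := acm_compatible acm u (phi a p v) ap.
rewrite acm_eta_phi mulr0 subr0 => <-; rewrite phi2.
rewrite (linear_funD (W := R^o) _ _ (gl _)) (linear_funN (W := R^o) _ (gl _)).
rewrite (linear_funZ (W := R^o) _ _ (gl _)) g_phi_xi scaler0 addr0.
by rewrite gsym.
Qed.

End AlmostContact.

Lemma derive_postcomp_linear (R : realType) (V W W' : normedModType R)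
    (L : {linear W -> W'}) (f : V -> W) x v : continuous L ->
  differentiable f x -> 'D_v (L \o f) x = L ('D_v f x).
Proof.
move=> cL df; have dL : differentiable L (f x) by exact: linear_differentiable.
rewrite (deriveE v df) deriveE; last exact: differentiable_comp.
by rewrite (diff_comp df dL) /= (diff_lin (f x) cL).
Qed.

(** * The canonical structure of the product on the sewing distribution *)

Section SewedCellsTheory.
Context {R : realType} {k : nat} (C : 'I_k -> cell R).
Let M := product_of_cells C.
Hypothesis k_gt0 : (0 < k)%N.
Implicit Types (b : chart M) (p : M).

Let sk : R := Num.sqrt k%:R.
Let sk0 : sk != 0.
Proof. by rewrite gt_eqF // sqrtr_gt0 ltr0n. Qed.

Definition eta_at b p i (u : 'M[R]_(k, 3)) : R :=
  @cell_eta _ (C i) (b i) (p i) (row i u).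

Lemma canonical_f_is_endo_field : is_endo_field (@canonical_f R k C).
Proof.
apply: (sum_lift_endo_is_endo_field (T := fun i => @cell_phi _ (C i))) => i.
exact: acm_phi (cell_acm (C i)).
Qed.

Lemma median_is_vfield : is_vfield (@median_vfield R k C).
Proof.
apply: (scaled_sum_lift_is_vfield _ (X := fun i => @cell_xi _ (C i))) => i.
exact: acm_xi (cell_acm (C i)).
Qed.

Lemma canonical_eta_is_covector_field i : is_covector_field
  (fun b p u => sk * canonical_eta i b p u : R).
Proof.
exact: scaled_proj_pullback_is_covector_field (acm_eta (cell_acm (C i))).
Qed.

Lemma canonical_g_is_metric : is_metric (@canonical_g R k C).
Proof.
apply: (sum_proj_pullback_is_metric (g := fun i => @cell_g _ (C i))) => i.
exact: acm_g (cell_acm (C i)).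
Qed.

Lemma row_canonical_f b p u i : chart_dom b p ->
  row i (canonical_f b p u) = @cell_phi _ (C i) (b i) (p i) (row i u).
Proof. exact: (row_sum_lift_endo (fun i => @cell_phi _ (C i))). Qed.

Lemma row_median b p (i : 'I_k) :
  row i (median_vfield b p) = sk^-1 *: @cell_xi _ (C i) (b i) (p i).
Proof. exact: (row_scaled_sum_lift_vfield _ (fun i => @cell_xi _ (C i))). Qed.

Lemma canonical_gE b p u v : chart_dom b p ->
  canonical_g b p u v =
  \sum_i @cell_g _ (C i) (b i) (p i) (row i u) (row i v).
Proof. exact: (sum_proj_pullback_bilinearE (fun i => @cell_g _ (C i))). Qed.

Lemma canonical_etaE b p i u : chart_dom b p ->
  canonical_eta i b p u = eta_at b p i u.
Proof.
by move=> bp; rewrite /canonical_eta /proj_pullback_covector d_projectionE.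
Qed.

Lemma eta_median b p (i : 'I_k) : chart_dom b p ->
  eta_at b p i (median_vfield b p) = sk^-1.
Proof.
move=> bp; have acm := cell_acm (C i).
rewrite /eta_at row_median.
rewrite (linear_funZ (W := R^o) _ _ (covector_linear (acm_eta acm) (bp i))).
by rewrite (acm_eta_xi acm (bp i)) -[_ *: _]/(_ * _) mulr1.
Qed.

Lemma eta_at_sewing b p u : chart_dom b p -> sewing_distribution b p u ->
  exists c : R, forall i : 'I_k, eta_at b p i u = c.
Proof.
move=> bp [v [c ->]]; exists (c * sk^-1) => j; have acm := cell_acm (C j).
rewrite -(eta_median j bp) /eta_at !linearD linearZ /= row_canonical_f //.
have el := covector_linear (acm_eta acm) (bp j).
rewrite (linear_funD (W := R^o) _ _ el) (linear_funZ (W := R^o) _ _ el).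
by rewrite (acm_eta_phi acm (bp j)) add0r.
Qed.

Lemma eta_sewing b p (i j : 'I_k) u :
  chart_dom b p -> sewing_distribution b p u ->
  eta_at b p i u = eta_at b p j u.
Proof. by move=> bp /(eta_at_sewing bp) [c E]; rewrite !E. Qed.

(** Holds for every [u]. When [u] is in the sewing distribution the coefficients coincide, and the
    sum becomes a multiple of the median field. *)
Lemma canonical_f_sewing b p u : chart_dom b p ->
  canonical_f b p (canonical_f b p u) =
    - u + \sum_i block i (eta_at b p i u *: @cell_xi _ (C i) (b i) (p i)).
Proof.
move=> bp; apply/row_matrixP => i; rewrite !row_canonical_f //.
rewrite (acm_phi2 (cell_acm (C i)) _ (bp i)) linearD linearN /=.
by rewrite row_sum_block.
Qed.

(** * The structure induced on an integral manifold *)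

Section Sewing.
Context (N : manifold 'rV[R]_(2 * k).+1) (iota : N -> M).
Hypothesis smooth_iota : smooth_map iota.
Hypothesis integral_iota : forall (a : chart N) b r,
  chart_dom a r -> chart_dom b (iota r) ->
  injective (tangent_map iota a b r) /\
  range (tangent_map iota a b r) = sewing_distribution b (iota r).

Let immersion (a : chart N) b r (ar : chart_dom a r)
  (br : chart_dom b (iota r)) := (integral_iota ar br).1.

Lemma tangent_sewing (a : chart N) b r v :
  chart_dom a r -> chart_dom b (iota r) ->
  sewing_distribution b (iota r) (tangent_map iota a b r v).
Proof. by move=> ar br; rewrite -(integral_iota ar br).2; exists v. Qed.

(** The distribution contains the image of [canonical_f] and the median field, so both are tangent
    to [N]; the form and the metric pull back along any smooth map. *)
Lemma exists_sewed_structure i : exists phi xi eta g,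
  sewed_structure i iota phi xi eta g.
Proof.
have [phi phiE] : exists phi, restricts_endo iota phi (@canonical_f R k C).
  apply: (exists_restriction_endo smooth_iota canonical_f_is_endo_field).
  move=> a b r v ar br; rewrite (integral_iota ar br).2.
  by exists (tangent_map iota a b r v), 0; rewrite scale0r addr0.
have [xi xiE] : exists xi, restricts_vfield iota xi (@median_vfield R k C).
  apply: (exists_restriction_vfield smooth_iota median_is_vfield).
  move=> a b r ar br; rewrite (integral_iota ar br).2.
  exists 0, 1; rewrite scale1r.
  by rewrite (linear_fun0 (endo_linear canonical_f_is_endo_field br)) add0r.
have [eta etaE] := exists_pullback_covector smooth_iota
  (canonical_eta_is_covector_field i).
have [g gE] := exists_pullback_bilinear smooth_iota canonical_g_is_metric.
by exists phi, xi, eta, g.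
Qed.

Variables (i0 : 'I_k) (phi : endo_field N) (xi : vfield N).
Variables (eta : covector_field N) (g : bilinear_field N).
Hypothesis phiE : restricts_endo iota phi (@canonical_f R k C).
Hypothesis xiE : restricts_vfield iota xi (@median_vfield R k C).
Hypothesis etaE : pullback_covector iota eta
  (fun b p u => sk * canonical_eta i0 b p u).
Hypothesis gE : pullback_bilinear iota g (@canonical_g R k C).

Lemma sewed_eta (a : chart N) b r v i :
  chart_dom a r -> chart_dom b (iota r) ->
  eta a r v = sk * eta_at b (iota r) i (tangent_map iota a b r v).
Proof.
move=> ar br; rewrite (etaE v ar br) canonical_etaE //.
by rewrite (eta_sewing i0 i br (tangent_sewing v ar br)).
Qed.

Lemma sewed_acm : almost_contact_metric phi xi eta g.
Proof.
have sk2 : sk * sk = k%:R by rewrite -expr2 sqr_sqrtr // ler0n.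
split.
- exact: (restriction_is_endo_field smooth_iota immersion
    canonical_g_is_metric gE canonical_f_is_endo_field phiE).
- exact: (restriction_is_vfield smooth_iota immersion
    canonical_g_is_metric gE median_is_vfield xiE).
- exact: (pullback_is_covector_field smooth_iota
    (canonical_eta_is_covector_field i0) etaE).
- exact: (pullback_is_metric smooth_iota immersion canonical_g_is_metric gE).
- move=> a r v ar; have [b br] := mfd_cover (manifoldP M) (iota r).
  (* Injectivity of the differential moves the identity to [M], where it is compared row by row,
     that is, cell by cell. *)
  apply: (immersion ar br).
  have tl := tangent_map_linear iota a b r.
  rewrite linear_funD // linear_funN // linear_funZ // xiE // !phiE //.
  rewrite canonical_f_sewing //; congr (_ + _); apply/row_matrixP => j.
  rewrite row_sum_block linearZ /= row_median scalerA.
  by rewrite (sewed_eta v j ar br) mulrAC divff // mul1r.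
- move=> a r ar; have [b br] := mfd_cover (manifoldP M) (iota r).
  by rewrite (sewed_eta _ i0 ar br) xiE // eta_median // divff.
move=> a r u v ar; have [b br] := mfd_cover (manifoldP M) (iota r).
rewrite !(gE _ _ ar br) !phiE // !canonical_gE //.
set Tu := tangent_map _ _ _ _ u; set Tv := tangent_map _ _ _ _ v.
(* Compatibility in each cell subtracts the same product; the k copies add up to
   [eta a r u * eta a r v] because [sk * sk] is k. *)
rewrite (eq_bigr (fun i =>
    @cell_g _ (C i) (b i) (iota r i) (row i Tu) (row i Tv) -
    eta a r u / sk * (eta a r v / sk))) => [|i _].
  rewrite big_split sumrN sumr_const card_ord /=; congr (_ - _).
  by rewrite -[_ *+ k]mulr_natr -sk2; field.
rewrite !row_canonical_f // (acm_compatible (cell_acm (C i)) _ _ (br i)).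
rewrite (sewed_eta u i ar br) (sewed_eta v i ar br).
by rewrite ![sk * _]mulrC !mulfK.
Qed.

(** The composite of [iota] with the projection to the l-th cell, in the charts [a] and [b l]. *)
Definition cell_rep (a : chart N) b l (x : 'rV[R]_(2 * k).+1) : 'rV[R]_3 :=
  row l (coord_rep iota a b x).

Lemma cell_rep_smooth m a b l :
  class_C m (coord_dom iota a b) (cell_rep a b l).
Proof.
exact: (class_C_postcomp (coord_dom_open a b smooth_iota.1)
  (@row_continuous R k 3 l) (coord_rep_smooth m a b smooth_iota)).
Qed.

Lemma cell_repP a b l x : coord_dom iota a b x ->
  (chart_map (b l) @` chart_dom (b l)) (cell_rep a b l x) /\
  chart_inv (b l) (cell_rep a b l x) = iota (chart_inv a x) l.
Proof.
move=> /coord_domP [_ bx _ -> cx]; split; last by [].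
by have := img_row l cx.
Qed.

Lemma row_tangent_map a b l x v : coord_dom iota a b x ->
  row l (tangent_map iota a b (chart_inv a x) v) = 'D_v (cell_rep a b l) x.
Proof.
move=> dx; rewrite (tangent_mapE v smooth_iota dx).
by rewrite -(derive_postcomp_linear v (@row_continuous R k 3 l)
  (coord_rep_differentiable smooth_iota dx)).
Qed.

(** The fundamental form of the l-th cell as a function of coordinates, the shape required by the
    pullback lemmas. *)
Definition cell_Phi b l (y u v : 'rV[R]_3) : R :=
  @cell_g _ (C l) (b l) (chart_inv (b l) y) u
    (@cell_phi _ (C l) (b l) (chart_inv (b l) y) v).

Let img b l : set 'rV[R]_3 := chart_map (b l) @` chart_dom (b l).

Let oimg b l : open (img b l).
Proof. exact: (mfd_image_open (manifoldP (C l)) (b l)). Qed.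

Let img_dom b l y : img b l y -> chart_dom (b l) (chart_inv (b l) y).
Proof. by move=> [r br <-]; rewrite (mfd_mapK (manifoldP (C l)) br). Qed.

Lemma cell_Phi_linear b l y u : img b l y -> scalar (cell_Phi b l y u).
Proof.
move=> /img_dom by_ c v w; have acm := cell_acm (C l).
rewrite /cell_Phi (endo_linear (acm_phi acm) by_).
exact: (metric_linear (acm_g acm) _ by_).
Qed.

Lemma cell_Phi_skew b l y u v : img b l y ->
  cell_Phi b l y u v = - cell_Phi b l y v u.
Proof. by move=> /img_dom by_; exact: (acm_skew (cell_acm (C l)) by_). Qed.

(** The lemmas on smoothness along a map are applied to the identity map and to constant vectors. *)
Lemma cell_Phi_differentiable b l y u v : img b l y ->
  differentiable (fun y => cell_Phi b l y u v) y.
Proof.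
move=> by_; have acm := cell_acm (C l).
have := metric_smooth_along (@oimg b l) (class_C_id 1 (img b l)) (fun _ => id)
  (acm_g acm) (class_C_cst 1 (img b l) u) (endo_smooth_along (@oimg b l)
  (class_C_id 1 (img b l)) (fun _ => id) (acm_phi acm)
  (class_C_cst 1 (img b l) v)).
by move=> [/(_ y by_)].
Qed.

Lemma cell_eta_differentiable b l y u : img b l y ->
  differentiable (fun y => @cell_eta _ (C l) (b l) (chart_inv (b l) y) u) y.
Proof.
move=> by_; have := covector_smooth (acm_eta (cell_acm (C l))) (b l) u 1.
by move=> [/(_ y by_)].
Qed.

(** With the next two lemmas, this prepares the hypotheses of [wedge_dim3] for the derivatives of
    [cell_Phi]. *)
Lemma cell_Phi_derive_linear b l y u v : img b l y ->
  scalar (fun z => 'D_z (fun y => cell_Phi b l y u v) y).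
Proof.
move=> by_ c z z'; have dPhi := cell_Phi_differentiable u v by_.
by rewrite !(deriveE _ dPhi) linearP.
Qed.

Lemma cell_Phi_derive_skew b l y z u v : img b l y ->
  'D_z (fun y => cell_Phi b l y u v) y = - 'D_z (fun y => cell_Phi b l y v u) y.
Proof.
move=> by_; have dPhi := cell_Phi_differentiable v u by_.
have := deriveN (diff_derivable dPhi : derivable _ _ z) => <-.
apply: near_eq_derive; apply: (open_nearT (@oimg b l) by_) => y' by'.
exact: cell_Phi_skew.
Qed.

Lemma cell_Phi_derive_linear2 b l y z v : img b l y ->
  scalar (fun u => 'D_z (fun y => cell_Phi b l y v u) y).
Proof.
move=> by_ c u u'.
have d w : derivable (fun y => cell_Phi b l y v w) y z.
  exact/diff_derivable/cell_Phi_differentiable.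
have := deriveD (derivableZ (k := c) (d u)) (d u'); rewrite deriveZ // => <-.
apply: near_eq_derive; apply: (open_nearT (@oimg b l) by_) => y' by'.
exact: cell_Phi_linear.
Qed.

(** * Exterior derivatives at a point of [N] *)

Section AtPoint.
Variables (a : chart N) (b : chart M) (r : N).
Hypotheses (ar : chart_dom a r) (br : chart_dom b (iota r)).
Let x := chart_map a r.
Let F := cell_rep a b.
Let U := coord_dom iota a b.

Let Ux : U x. Proof. by exists r. Qed.
Let oU : open U. Proof. exact: coord_dom_open smooth_iota.1. Qed.
Let CF l : class_C 2 U (F l). Proof. exact: cell_rep_smooth. Qed.
Let imgFx l : img b l (F l x). Proof. exact: (cell_repP l Ux).1. Qed.

Let FxE l : F l x = chart_map (b l) (iota r l).
Proof.
rewrite /F /cell_rep /coord_rep /= row_chart_map.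
by rewrite (mfd_mapK (manifoldP N) ar).
Qed.

Lemma sewed_eta_derive l v :
  eta a r v = sk * @cell_eta _ (C l) (b l) (iota r l) ('D_v (F l) x).
Proof.
rewrite (sewed_eta v l ar br) /eta_at; have := row_tangent_map l v Ux.
by rewrite /x (mfd_mapK (manifoldP N) ar) => ->.
Qed.

Lemma sewed_eta_rep y v : U y -> eta a (chart_inv a y) v =
  sk * @cell_eta _ (C i0) (b i0) (chart_inv (b i0) (F i0 y)) ('D_v (F i0) y).
Proof.
move=> Uy; have [ay by_ _ _ _] := coord_domP Uy.
rewrite (sewed_eta v i0 ay by_) /eta_at (row_tangent_map _ _ Uy).
by rewrite (cell_repP i0 Uy).2.
Qed.

Lemma fundamental_form_rep y u : U y ->
  fundamental_form phi g a (chart_inv a y) u =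
  \sum_l cell_Phi b l (F l y) ('D_(u ord0) (F l) y) ('D_(u ord_max) (F l) y).
Proof.
move=> Uy; have [ay by_ _ _ _] := coord_domP Uy.
rewrite /fundamental_form (gE _ _ ay by_) phiE // canonical_gE //.
apply: eq_bigr => l _; rewrite row_canonical_f // !(row_tangent_map _ _ Uy).
by rewrite /cell_Phi (cell_repP l Uy).2.
Qed.

Lemma sewed_ext_deriv_eta u v :
  ('D_u (fun y => eta a (chart_inv a y) v) x : R) -
  'D_v (fun y => eta a (chart_inv a y) u) x = 0.
Proof.
pose w y := @cell_eta _ (C i0) (b i0) (chart_inv (b i0) y).
have wl y : img b i0 y -> scalar (w y).
  by move=> /img_dom; exact: (covector_linear (acm_eta (cell_acm (C i0)))).
have dw z : differentiable (w^~ z) (F i0 x) by exact: cell_eta_differentiable.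
have D s t : 'D_s (fun y => eta a (chart_inv a y) t) x =
    sk * 'D_s (fun y => w (F i0 y) ('D_t (F i0) y)) x.
  have [d1 _] := derive_pullback1 Ux (CF i0) (@oimg b i0) (imgFx i0) s t wl dw.
  rewrite -(deriveMl sk d1); apply: near_eq_derive.
  by apply: (open_nearT oU Ux) => y Uy; exact: sewed_eta_rep.
rewrite !D -mulrBr.
rewrite (ext_deriv_pullback1 oU Ux (CF i0) (@oimg b i0) (imgFx i0) u v wl dw).
(* The closed form of the cell is evaluated on the two pushed forward vectors. *)
have := cell_closed (c := C i0) (fun i : 'I_2 => if i == ord0 then 'D_u (F i0) x
  else 'D_v (F i0) x) (br i0).
rewrite /ext_deriv !big_ord_recl big_ord0 -FxE /form_of_covector /=.
by rewrite /bump /= expr0 mul1r addr0 expr1 mulN1r => ->; rewrite mulr0.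
Qed.

(** A single term of d of the cell's fundamental form, skew in [v] and [w] only; the exterior
    derivative is its signed sum over the choice of the differentiated direction. *)
Definition cell_dPhi l (u v w : 'rV[R]_3) : R :=
  'D_u (fun y => cell_Phi b l y v w) (F l x).

Lemma ext_deriv_fundamental_form (z : 'I_3 -> 'rV[R]_(2 * k).+1) :
  ext_deriv (fundamental_form phi g) a r z =
  \sum_l \sum_(j < 3) (-1) ^+ j * cell_dPhi l ('D_(z j) (F l) x)
    ('D_(z (lift j ord0)) (F l) x) ('D_(z (lift j ord_max)) (F l) x).
Proof.
pose h l u v y := cell_Phi b l (F l y) ('D_u (F l) y) ('D_v (F l) y).
have wl l y u : img b l y -> scalar (cell_Phi b l y u).
  exact: cell_Phi_linear.
have wN l y u v : img b l y -> cell_Phi b l y u v = - cell_Phi b l y v u.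
  exact: cell_Phi_skew.
have dw l u v : differentiable (fun y => cell_Phi b l y u v) (F l x).
  exact: cell_Phi_differentiable.
have wll l y u : img b l y -> scalar (cell_Phi b l y ^~ u).
  by move=> Uy c v v'; rewrite !(wN l y _ u Uy) wl // opprD mulrN.
(* Allows the sum over the cells to be differentiated term by term. *)
have dh l s u v : derivable (h l u v) x s.
  exact: (derive_pullback2 Ux (CF l) (@oimg b l) (imgFx l) s u v
    (wl l) (wll l) (dw l)).1.
transitivity (\sum_(j < 3) \sum_l (-1) ^+ j *
    'D_(z j) (h l (z (lift j ord0)) (z (lift j ord_max))) x).
  apply: eq_bigr => j _; rewrite -mulr_sumr; congr (_ * _).
  rewrite -derive_sum //; apply: near_eq_derive.
  apply: (open_nearT oU Ux) => y Uy; rewrite fundamental_form_rep //.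
  by rewrite fct_sumE.
rewrite exchange_big; apply: eq_bigr => l _.
exact: (ext_deriv_pullback2 oU Ux (CF l) (@oimg b l) (imgFx l) z
  (wl l) (wN l) (dw l)).
Qed.

(** In the l-th summand of d of the fundamental form, [eta] is expressed through the covector of
    that same cell. All vectors then enter through their projections to one 3-dimensional tangent
    space, where [wedge_dim3] applies. *)
Lemma sewed_wedge (v : 'I_4 -> 'rV[R]_(2 * k).+1) :
  wedge1 eta (ext_deriv (fundamental_form phi g)) a r v = 0.
Proof.
pose e l := @cell_eta _ (C l) (b l) (iota r l).
transitivity (\sum_l sk * \sum_(i < 4) (-1) ^+ i * (e l ('D_(v i) (F l) x) *
    \sum_(j < 3) (-1) ^+ j * cell_dPhi l ('D_(v (lift i j)) (F l) x)
    ('D_(v (lift i (lift j ord0))) (F l) x)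
    ('D_(v (lift i (lift j ord_max))) (F l) x))).
  under [RHS]eq_bigr do rewrite mulr_sumr.
  rewrite exchange_big; apply: eq_bigr => i _.
  rewrite ext_deriv_fundamental_form mulr_sumr mulr_sumr.
  by apply: eq_bigr => l _; rewrite (sewed_eta_derive l) -mulrA mulrCA.
apply: big1 => l _; rewrite [X in _ * X](_ : _ = 0) ?mulr0 //.
apply: (@wedge_dim3 R (e l) (cell_dPhi l) (fun i => 'D_(v i) (F l) x)).
- exact: (covector_linear (acm_eta (cell_acm (C l))) (br l)).
- by move=> u w; exact: cell_Phi_derive_linear.
- move=> u w c s t; rewrite /cell_dPhi.
  rewrite !(cell_Phi_derive_skew u _ w (imgFx l)).
  by rewrite (cell_Phi_derive_linear2 _ _ (imgFx l)) opprD mulrN.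
by move=> u s t; exact: cell_Phi_derive_skew.
Qed.

End AtPoint.

Lemma sewed_eta_closed : form_eq0 (ext_deriv (form_of_covector eta)).
Proof.
move=> a r v ar; have [b br] := mfd_cover (manifoldP M) (iota r).
rewrite /ext_deriv !big_ord_recl big_ord0 /form_of_covector /=.
rewrite (_ : lift (lift ord0 ord0) ord0 = ord0 :> 'I_2); last exact: val_inj.
rewrite /bump /= expr0 mul1r addr0 expr1 mulN1r.
exact: (sewed_ext_deriv_eta ar br).
Qed.

Lemma sewed_wedge_eq0 :
  form_eq0 (wedge1 eta (ext_deriv (fundamental_form phi g))).
Proof.
move=> a r v ar; have [b br] := mfd_cover (manifoldP M) (iota r).
exact: (sewed_wedge ar br).
Qed.

End Sewing.
End SewedCellsTheory.

Theorem theorem2 (R : realType) (k : nat) (hk : (2 <= k)%N)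
    (C : 'I_k -> cell R) (N : manifold 'rV[R]_(2 * k).+1)
    (iota : N -> product_of_cells C) (hN : sewed_cells iota) :
  (exists phi xi eta g,
     sewed_structure (Ordinal (ltnW hk)) iota phi xi eta g) /\
  (forall phi xi eta g,
     sewed_structure (Ordinal (ltnW hk)) iota phi xi eta g ->
     [/\ almost_contact_metric phi xi eta g,
         form_eq0 (ext_deriv (form_of_covector eta)) &
         form_eq0 (wedge1 eta (ext_deriv (fundamental_form phi g)))]).
Proof.
have [[smooth_iota _ integral_iota] _ _ _] := hN.
split; first exact: (exists_sewed_structure smooth_iota integral_iota).
move=> phi xi eta g [phiE xiE etaE gE]; split.
- exact: (sewed_acm (ltnW hk) smooth_iota integral_iota phiE xiE etaE gE).
- exact: (sewed_eta_closed smooth_iota integral_iota etaE).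
- exact: (sewed_wedge_eq0 smooth_iota integral_iota phiE etaE gE).
Qed.
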